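(* Let $\alpha \in \mathbb{R}$, $\beta \in \mathbb{R}_{>0}$, $x,y \in (0,1)$, let $q = 1-\beta/N$, and let $w$ be the random permutation of $\{1,\dots,N\}$ distributed according to the Mallows measure $\mathcal{M}_N^q$. Then $$\lim_{N \to \infty} \frac{\sqrt{2 \pi N}}{ \sigma_{\beta}(x,y) }\, \mathrm{Prob} \left( H_{\lfloor xN \rfloor,\lfloor yN \rfloor}(w) = \lfloor h_{\beta}(x, y) N + \alpha \sqrt{N} \rfloor \right) = \exp \left( -\frac{ \sigma_{\beta}^2(x,y) }{2} \alpha^2 \right).$$
   Context: For $q\in[0,1)$, the Mallows measure $\mathcal{M}_N^q$ on permutations of $\{1,\dots,N\}$ assigns to a permutation $w$ the probability $q^{\mathrm{inv}(w)}Y_N$, where $\mathrm{inv}(w)$ is the number of inversions of $w$ and $Y_N=\prod_{j=1}^N\frac{1-q}{1-q^j}$ is the normalization constant. With $q=1-\beta/N$ one considers $N$ large enough that $q\in[0,1)$. The height function of a permutation $w$ of size $N$ is $H_{L,K}(w) := \#\{ i : 1 \le i \le L,\ 1 \le w(i) \le K \}$ for integers $1\le L\le N$, $1\le K\le N$. For $\beta>0$ and $(x,y)\in(0,1)^2$: $$h_{\beta}(x, y) := \frac{1}{\beta}\left[\ln(1-e^{-\beta})-\ln(e^{-\beta x}+e^{-\beta y}-e^{-\beta(x+y)}-e^{-\beta})\right],$$ $$\sigma_{\beta}(x,y):=\sqrt{ \frac{ \beta (1- e^{-\beta})}{ (1- e^{- \beta(x-h_{\beta}(x, y))}) (1- e^{-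 \beta(y-h_{\beta}(x, y))}) } }.$$ *)

(* Defs.v *)
From HB Require Import structures.
From mathcomp Require Import all_boot all_order all_fingroup all_algebra.
From mathcomp Require Import all_classical all_reals all_analysis.
Set Implicit Arguments.
Unset Strict Implicit.
Unset Printing Implicit Defensive.
Import Order.TTheory GRing.Theory Num.Theory.

Local Open Scope ring_scope.

(* Permutations of {1, ..., N} are encoded as permutations of
   'I_N = {0, ..., N-1}: the integer i stands for i + 1. *)

Definition inversions (N : nat) (w : 'S_N) : nat :=
  #|[set ij : 'I_N * 'I_N | (ij.1 < ij.2)%N && (w ij.2 < w ij.1)%N]|.

Definition mallows_norm (R : realType) (q : R) (N : nat) : R :=
  \prod_(1 <= j < N.+1) ((1 - q) / (1 - q ^+ j)).

Definition mallows (R : realType) (q : R) (N : nat) (w : 'S_N) : R :=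
  q ^+ inversions w * mallows_norm q N.

(* No constraint on q is built in; this is a probability when 0 <= q < 1. *)
Definition mallows_prob (R : realType) (q : R) (N : nat) (E : pred 'S_N) : R :=
  \sum_(w : 'S_N | E w) mallows q w.

(* After the shift of indices, 1 <= i <= L and 1 <= w(i) <= K read
   i < L and w i < K. *)
Definition height (N L K : nat) (w : 'S_N) : nat :=
  #|[set i : 'I_N | (i < L)%N && (w i < K)%N]|.

Definition h_beta (R : realType) (beta x y : R) : R :=
  beta^-1 * (ln (1 - expR (- beta)) -
    ln (expR (- beta * x) + expR (- beta * y)
        - expR (- beta * (x + y)) - expR (- beta))).

Definition sigma_beta (R : realType) (beta x y : R) : R :=
  Num.sqrt (beta * (1 - expR (- beta)) /
    ((1 - expR (- beta * (x - h_beta beta x y))) *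
     (1 - expR (- beta * (y - h_beta beta x y))))).

(* Main.v *)
Require Import Defs.
From mathcomp Require Import all_boot all_order all_fingroup all_algebra.
From mathcomp Require Import ring lra zify.
From mathcomp Require Import all_classical all_reals all_analysis measurable_realfun.
Set Implicit Arguments.
Unset Strict Implicit.
Unset Printing Implicit Defensive.
Import Order.TTheory GRing.Theory Num.Theory.
Import numFieldNormedType.Exports.
Local Open Scope ring_scope.

(** Write L, K for the integer parts of x N, y N, and m for the value of the
height function.

The law of the height function is explicit.  Removing the last letter of a
permutation gives a recursion in N for its probabilities ([mallows_prob_rec]),
and the solution is the q-hypergeometric law ([mallows_height])
<<
  P(m) = [K, m] [N - K, L - m] q^((L - m)(K - m)) / [N, L]
>>
where [n, k] is the Gaussian binomial coefficient.  Its consecutive ratios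
P(m+1) / P(m) are products of few factors 1 - q^n, and they decrease with m: the
law is log-concave.

For q = 1 - beta / N, the logarithm of the ratio is close to a smooth function of
m / N, which vanishes at h = h_beta(x, y) ([lnm_critical]) and has derivative
- sigma_beta(x, y)^2 there ([sqr_sigma_beta]).  Hence, with an error
o(1 / sqrt N) which is uniform for |m - h N| <= T sqrt N
([logratio_first_order]),
<<
  ln P(m+1) - ln P(m) = - sigma^2 (m - h N) / N + o(1 / sqrt N).
>>

The local limit theorem follows from this estimate, log-concavity and total mass
one ([log_concave_local_limit]), with no asymptotics of the normalizing constants.
Summing the increments, the profile t |-> P(h N + t sqrt N) / P(h N) converges
pointwise to exp(- sigma^2 t^2 / 2).  By log-concavity ln P lies below its
tangents at h N + sqrt N and h N - sqrt N, so the profile is dominated by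
C exp(- sigma^2 |t| / 2).  Its integral is 1 / (sqrt N P(h N)) because the
probabilities sum to 1, and dominated convergence gives the limit of sqrt N P(h N)
as the inverse of a Gaussian integral. *)

(** * Removing the last letter of a permutation *)

Section PermLast.
Variable N : nat.
Implicit Types (v : 'I_N.+1) (s : 'S_N).

Lemma bump_ltn (v a b : nat) : (bump v a < bump v b)%N = (a < b)%N.
Proof. by rewrite /bump; case: (leqP v a); case: (leqP v b); lia. Qed.

(** A permutation of N + 1 points is determined by its last value v and by the
permutation s of N points obtained by deleting that value. *)
Lemma big_perm_last (T : Type) (idx : T) (op : Monoid.com_law idx)
    (F : 'S_N.+1 -> T) :
  \big[op/idx]_(w : 'S_N.+1) F w =
  \big[op/idx]_(v < N.+1) \big[op/idx]_(s : 'S_N) F (lift_perm ord_max v s).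
Proof.
rewrite pair_big /= (reindex (fun vs => lift_perm ord_max vs.1 vs.2)) //=.
apply: onW_bij; apply: inj_card_bij => /=; last first.
  by rewrite card_prod card_ord !card_Sn factS.
move=> [v s] [v' s'] /= E.
have vE : v = v' by have := congr1 (fun t : 'S_N.+1 => t ord_max) E; rewrite !lift_perm_id.
subst v'; congr (_, _); apply/permP => i.
have := congr1 (fun t : 'S_N.+1 => t (lift ord_max i)) E.
by rewrite !lift_perm_lift => /lift_inj.
Qed.

Lemma lift_perm_max v s : lift_perm ord_max v s ord_max = v.
Proof. exact: lift_perm_id. Qed.

Lemma lift_perm_widen v s (i : 'I_N) :
  lift_perm ord_max v s (widen_ord (leqnSn N) i) = lift v (s i).
Proof.
rewrite -(lift_perm_lift ord_max v s i); congr (lift_perm _ _ _ _).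
by apply: val_inj => /=; rewrite /bump leqNgt ltn_ord.
Qed.

Lemma card_sum_ord n (P : pred ('I_n)) : #|[set i | P i]| = (\sum_(i < n) P i)%N.
Proof. by rewrite -sum1_card big_mkcond; apply: eq_bigr => i _; rewrite inE; case: (P i). Qed.

Lemma inversions_sum n (w : 'S_n) :
  inversions w = (\sum_(i < n) \sum_(j < n) ((i < j) && (w j < w i)))%N.
Proof.
rewrite /inversions -sum1_card big_mkcond pair_big /=.
by apply: eq_bigr => -[i j] _; rewrite inE /=; case: (_ && _).
Qed.

(** The last letter v creates one inversion with each of the N - v larger values. *)
Lemma inversions_lift_perm v s :
  inversions (lift_perm ord_max v s) = (inversions s + (N - v))%N.
Proof.
rewrite !inversions_sum big_ord_recr /= [X in (_ + X)%N]big1 ?addn0; last first.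
  by move=> j _; rewrite ltnNge -ltnS ltn_ord.
under eq_bigr => i _.
  rewrite big_ord_recr /= lift_perm_max lift_perm_widen /= ltn_ord /=.
  under eq_bigr => j _ do rewrite lift_perm_widen /= bump_ltn.
  over.
rewrite big_split /=; congr (_ + _)%N.
(* The inversions with the last letter are counted by value, not by position. *)
rewrite (reindex_inj (@perm_inj _ s^-1%g)) /=.
under eq_bigr => i _ do rewrite permKV.
have -> : (\sum_(i < N) (v < bump v i) = \sum_(v <= i < N) 1)%N.
  rewrite -(big_mkord xpredT (fun i => nat_of_bool (v < bump v i)%N)).
  have vN : (v <= N)%N by rewrite -ltnS.
  rewrite (big_cat_nat (n := v)) //= big_nat_cond big1 ?add0n.
    rewrite big_nat_cond [RHS]big_nat_cond; apply: eq_bigr => i.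
    by rewrite andbT /bump => /andP[vi _]; rewrite vi add1n ltnS vi.
  by move=> i; rewrite andbT /bump => /andP[_ iv]; case: (leqP v i); lia.
by rewrite sum_nat_const_nat muln1.
Qed.

Lemma height_lift_perm v s (L K : nat) : (L <= N)%N ->
  height L K (lift_perm ord_max v s) = height L (if (v < K)%N then K.-1 else K) s.
Proof.
move=> LN; rewrite /height !card_sum_ord big_ord_recr /= ltnNge LN addn0.
apply: eq_bigr => i _; rewrite lift_perm_widen /= /bump.
congr (nat_of_bool (_ && _)).
by case: (ltnP v K) => vK; case: (leqP v (s i)) => vs; lia.
Qed.

End PermLast.

(** * The law of the height function *)

Section Mallows.
Variables (R : realType) (q : R).
Hypothesis q01 : 0 < q < 1.

Lemma qpow_lt1 n : (0 < n)%N -> q ^+ n < 1.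
Proof. by move=> n0; case/andP: q01 => /ltW q0 q1; rewrite exprn_ilt1 // -lt0n. Qed.

Lemma subr_qpow_gt0 n : (0 < n)%N -> 0 < 1 - q ^+ n.
Proof. by move=> n0; rewrite subr_gt0 qpow_lt1. Qed.

(** The geometric sum over a range of last values v. *)
Lemma qpow_sum (N a b : nat) : (a <= b <= N.+1)%N ->
  (1 - q) * \sum_(a <= v < b) q ^+ (N - v) = q ^+ (N.+1 - b) - q ^+ (N.+1 - a).
Proof.
move=> /andP[ab bN].
rewrite -(telescope_sumr (fun v => q ^+ (N.+1 - v))) // mulr_sumr.
rewrite big_nat_cond [RHS]big_nat_cond; apply: eq_bigr => v /andP[/andP[_ vb] _].
rewrite subSS mulrBl mul1r -exprS -subSn //; lia.
Qed.

(** Conditioning on the last value v: deleting it lowers K by one when v < K, and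
leaves K unchanged otherwise; the two terms collect these two cases. *)
Lemma mallows_prob_rec (N L K m : nat) : (L <= N)%N -> (K <= N.+1)%N ->
  (1 - q ^+ N.+1) * mallows_prob q (fun w : 'S_N.+1 => height L K w == m) =
  q ^+ (N.+1 - K) * (1 - q ^+ K) * mallows_prob q (fun w : 'S_N => height L K.-1 w == m) +
  (1 - q ^+ (N.+1 - K)) * mallows_prob q (fun w : 'S_N => height L K w == m).
Proof.
move=> LN KN; rewrite {1}/mallows_prob big_mkcond big_perm_last /=.
have E v : \sum_(s : 'S_N) (if height L K (lift_perm ord_max v s) == m then
    mallows q (lift_perm ord_max v s) else 0) =
   q ^+ (N - v) * ((1 - q) / (1 - q ^+ N.+1)) *
   mallows_prob q (fun w : 'S_N => height L (if (v < K)%N then K.-1 else K) w == m).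
  rewrite /mallows_prob -big_mkcond mulr_sumr; apply: eq_big => s.
    by rewrite height_lift_perm.
  move=> _; rewrite /mallows inversions_lift_perm /mallows_norm big_nat_recr //= exprD.
  ring.
under eq_bigr do rewrite E.
have qN0 : 1 - q ^+ N.+1 != 0 by rewrite gt_eqF // subr_qpow_gt0.
rewrite -(big_mkord xpredT (fun v => q ^+ (N - v) * ((1 - q) / (1 - q ^+ N.+1)) *
   mallows_prob q (fun w : 'S_N => height L (if (v < K)%N then K.-1 else K) w == m))).
have S a b (P : R) : (a <= b <= N.+1)%N ->
    (1 - q ^+ N.+1) * \sum_(a <= v < b) q ^+ (N - v) * ((1 - q) / (1 - q ^+ N.+1)) * P =
    (q ^+ (N.+1 - b) - q ^+ (N.+1 - a)) * P.
  by move=> /qpow_sum <-; rewrite -!mulr_suml; field.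
rewrite (big_cat_nat (n := K)) //= mulrDr; congr (_ + _).
  rewrite big_nat_cond.
  under eq_bigr => i /andP[/andP[_ iK] _] do rewrite iK.
  by rewrite -big_nat_cond S ?leq0n // subn0 mulrBr mulr1 -exprD subnK.
rewrite big_nat_cond.
under eq_bigr => i /andP[/andP[iK _] _] do rewrite ltnNge iK /=.
by rewrite -big_nat_cond S ?KN ?leqnn // subnn expr0.
Qed.

(** The case L = K = 0 of the recursion: the height is then always 0. *)
Lemma mallows_total N : mallows_prob q (fun w : 'S_N => true) = 1.
Proof.
elim: N => [|N IH].
  rewrite /mallows_prob (eq_bigr (fun=> 1)).
    by rewrite sumr_const -cardsE cardsT card_Sn.
  move=> w _; rewrite /mallows inversions_sum big_ord0 expr0 mul1r.
  by rewrite /mallows_norm big_geq.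
have H0 n : mallows_prob q (fun w : 'S_n => height 0 0 w == 0) =
    mallows_prob q (fun w : 'S_n => true).
  by apply: eq_bigl => w; rewrite /height card_sum_ord big1.
have := @mallows_prob_rec N 0 0 0 (leq0n _) (leq0n _).
rewrite !H0 IH subn0 expr0 subrr mulr0 mul0r add0r.
by move/mulfI; apply; rewrite gt_eqF // subr_qpow_gt0.
Qed.

(** The q-Pochhammer product (1 - q)(1 - q^2) ... (1 - q^n). *)
Definition qfact n : R := \prod_(1 <= j < n.+1) (1 - q ^+ j).

Lemma qfact0 : qfact 0 = 1.
Proof. by rewrite /qfact big_geq. Qed.

Lemma qfactS n : qfact n.+1 = qfact n * (1 - q ^+ n.+1).
Proof. by rewrite /qfact big_nat_recr. Qed.

Lemma qfact_gt0 n : 0 < qfact n.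
Proof.
elim: n => [|n IH]; first by rewrite qfact0.
by rewrite qfactS mulr_gt0 // subr_qpow_gt0.
Qed.

(** The Gaussian binomial coefficient, zero when k > n.  The powers of 1 - q in the
q-factorials cancel, so they are replaced by q-Pochhammer products. *)
Definition qbinom n k : R :=
  if (k <= n)%N then qfact n / (qfact k * qfact (n - k)) else 0.

Lemma qbinom_gt0 n k : (k <= n)%N -> 0 < qbinom n k.
Proof. by move=> kn; rewrite /qbinom kn divr_gt0 ?mulr_gt0 ?qfact_gt0. Qed.

Lemma qbinom_gtn n k : (n < k)%N -> qbinom n k = 0.
Proof. by move=> kn; rewrite /qbinom leqNgt kn. Qed.

Lemma qbinomnn n : qbinom n n = 1.
Proof. by rewrite /qbinom leqnn subnn qfact0 mulr1 divff ?gt_eqF ?qfact_gt0. Qed.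

Lemma qbinom_recl n k :
  (1 - q ^+ n.+1) * qbinom n k = (1 - q ^+ (n.+1 - k)) * qbinom n.+1 k.
Proof.
rewrite /qbinom; have [kn|nk] := leqP k n.
  rewrite (leqW kn) subSn // !qfactS.
  have := qfact_gt0 k; have := qfact_gt0 (n - k).
  have := @subr_qpow_gt0 (n - k).+1 isT.
  move=> /lt0r_neq0 A /lt0r_neq0 B /lt0r_neq0 C.
  by field; rewrite A B C.
rewrite mulr0; case: leqP => kn; last by rewrite mulr0.
by rewrite (_ : n.+1 - k = 0)%N ?expr0 ?subrr ?mul0r //; lia.
Qed.

Lemma qbinom_recr n k : (k < n)%N ->
  (1 - q ^+ k.+1) * qbinom n k.+1 = (1 - q ^+ (n - k)) * qbinom n k.
Proof.
move=> kn; rewrite /qbinom kn (ltnW kn) (_ : n - k = (n - k.+1).+1)%N; last by lia.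
rewrite !qfactS.
have := qfact_gt0 k; have := qfact_gt0 (n - k.+1).
have := @subr_qpow_gt0 (n - k.+1).+1 isT; have := @subr_qpow_gt0 k.+1 isT.
move=> /lt0r_neq0 A /lt0r_neq0 B /lt0r_neq0 C /lt0r_neq0 D.
by field; rewrite A B C D.
Qed.

Lemma sum_ltn_ord N K : (K <= N)%N -> (\sum_(i < N) (i < K) = K)%N.
Proof.
move=> KN; have := @big_ord_widen _ 0%N addn K N (fun=> 1%N) KN.
rewrite sum_nat_const card_ord muln1 => {2}->.
by rewrite [RHS]big_mkcond; apply: eq_bigr => i _; case: ltnP.
Qed.

Lemma height_full N K (w : 'S_N) : (K <= N)%N -> height N K w = K.
Proof.
move=> KN; rewrite /height card_sum_ord -[RHS](sum_ltn_ord KN).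
rewrite (reindex_inj (@perm_inj _ w^-1%g)) /=.
by apply: eq_bigr => i _; rewrite ltn_ord permKV.
Qed.

Lemma height_le N L K (w : 'S_N) : (L <= N)%N -> (height L K w <= L)%N.
Proof.
move=> LN; rewrite /height card_sum_ord -[leqRHS](sum_ltn_ord LN).
by apply: leq_sum => i _; case: (i < L)%N => //=; exact: leq_b1.
Qed.

(** The distribution of the height function is the q-hypergeometric law.  The proof
is by induction on N, starting from N = L, where the height is equal to K. *)
Lemma mallows_height N L K m : (m <= L)%N -> (L <= N)%N -> (K <= N)%N ->
  qbinom N L * mallows_prob q (fun w : 'S_N => height L K w == m) =
  qbinom K m * qbinom (N - K) (L - m) * q ^+ ((L - m) * (K - m)).
Proof.
move=> mL LN; rewrite -(subnKC LN); elim: (N - L)%N K => [|n IH] K.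
  rewrite addn0 => KL.
  have -> : mallows_prob q (fun w : 'S_L => height L K w == m) = (K == m)%:R.
    transitivity ((K == m)%:R * mallows_prob q (fun w : 'S_L => true)).
      rewrite /mallows_prob mulr_sumr big_mkcond; apply: eq_bigr => w _.
      by rewrite height_full //; case: (K == m); rewrite ?mul1r ?mul0r.
    by rewrite mallows_total mulr1.
  rewrite qbinomnn mul1r; have [Km|] := eqVneq K m.
    by rewrite Km !qbinomnn subnn muln0 !mul1r.
  rewrite neq_ltn => /orP[Km|mK]; first by rewrite qbinom_gtn // !mul0r.
  by rewrite [qbinom (L - K) _]qbinom_gtn ?mulr0 ?mul0r //; lia.
rewrite addnS => KN; set M := (L + n)%N in IH KN *.
have LM : (L <= M)%N by rewrite leq_addr.
have qM : 1 - q ^+ M.+1 != 0 by rewrite gt_eqF // subr_qpow_gt0.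
have qML : 1 - q ^+ (M.+1 - L) != 0 by rewrite gt_eqF // subr_qpow_gt0 // subn_gt0.
apply: (mulfI qML); rewrite mulrA -qbinom_recl.
rewrite mulrAC mulrA mallows_prob_rec // mulrDl.
(* By absorption, both terms of the recursion are multiples of
   [K, m] [M + 1 - K, L - m]. *)
have -> : q ^+ (M.+1 - K) * (1 - q ^+ K) *
  mallows_prob q (fun w : 'S_M => height L K.-1 w == m) * qbinom M L =
  q ^+ (M.+1 - K) * (1 - q ^+ (K - m)) * q ^+ ((L - m) * (K.-1 - m)) *
   (qbinom K m * qbinom (M.+1 - K) (L - m)).
  case: K KN => [|k] kM; first by rewrite sub0n expr0 subrr !(mulr0, mul0r).
  rewrite -mulrA [_ * qbinom M L]mulrC IH //= subSS.
  have := qbinom_recl k m; move: (qbinom _ _) (qbinom _ _) (qbinom _ _).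
  move: (q ^+ _) (q ^+ _) (q ^+ _) (q ^+ _) => d c b a C B A E.
  by transitivity (c * d * C * ((1 - a) * A)); [ring|rewrite E; ring].
have -> : (1 - q ^+ (M.+1 - K)) *
  mallows_prob q (fun w : 'S_M => height L K w == m) * qbinom M L =
  (1 - q ^+ (M.+1 - K - (L - m))) * q ^+ ((L - m) * (K - m)) *
   (qbinom K m * qbinom (M.+1 - K) (L - m)).
  have [kM|Mk] := leqP K M; last first.
    have -> : (M.+1 - K = 0)%N by lia.
    by rewrite sub0n expr0 subrr !mul0r.
  rewrite -mulrA [_ * qbinom M L]mulrC IH // (subSn kM).
  have := qbinom_recl (M - K) (L - m); move: (qbinom _ _) (qbinom _ _) (qbinom _ _).
  move: (q ^+ _) (q ^+ _) (q ^+ _) => c b a C B A E.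
  by transitivity (c * C * ((1 - a) * A)); [ring|rewrite E; ring].
have [Km|mK] := ltnP K m; first by rewrite (qbinom_gtn Km) !(mul0r, mulr0) addr0.
have [LK|KL] := ltnP (M.+1 - K) (L - m).
  by rewrite (qbinom_gtn LK) !(mul0r, mulr0) addr0.
set Q := qbinom K m * _.
have [b bE] : exists b, (M.+1 - K = (L - m) + b)%N.
  by exists (M.+1 - K - (L - m))%N; lia.
have -> : (M.+1 - L = (K - m) + b)%N by lia.
rewrite bE addKn.
have [[d dE]|->] : (exists d, K - m = d.+1)%N \/ (K - m = 0)%N.
    by case: (K - m)%N => [|d]; [right|left; exists d].
  have -> : (K.-1 - m = d)%N by lia.
  rewrite dE mulnS !exprD.
  set u := q ^+ (L - m); set v := q ^+ ((L - m) * d); set z := q ^+ d.+1; set c := q ^+ b.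
  ring.
rewrite muln0 !expr0 subrr add0n; ring.
Qed.

End Mallows.

(** * Preliminaries on limits and integrals *)

Local Open Scope classical_set_scope.
Local Open Scope ring_scope.

Lemma cvg_near_eq (T : Type) (U : topologicalType) (F : set_system T) (f g : T -> U) (l : U) :
  Filter F -> (\forall x \near F, f x = g x) -> f @ F --> l -> g @ F --> l.
Proof.
move=> FF fg fl; apply: (cvg_trans _ fl); apply: near_eq_cvg.
by apply: filterS fg => x ->.
Qed.

Section Sqrt.
Variable R : realType.

Lemma near_sqrt_ge (A : R) : \forall N \near \oo, A <= Num.sqrt N%:R.
Proof.
near=> N.
have [A0|A0] := leP A 0; first exact: le_trans (sqrtr_ge0 _).
rewrite -(ger0_norm (ltW A0)) -sqrtr_sqr ler_wsqrtr //.
by near: N; exact: nbhs_infty_ger.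
Unshelve. all: by end_near. Qed.

Lemma near_invsqrt_le (e : R) : 0 < e -> \forall N \near \oo, (Num.sqrt N%:R)^-1 <= e.
Proof.
move=> e0; near=> N; rewrite invf_ple ?posrE //; last first.
  by rewrite sqrtr_gt0 ltr0n; near: N; exact: nbhs_infty_gt.
by near: N; exact: near_sqrt_ge.
Unshelve. all: by end_near. Qed.

Lemma near_sqrt_gt0 : \forall N \near \oo, 0 < Num.sqrt (N%:R : R).
Proof.
by near=> N; rewrite sqrtr_gt0 ltr0n; near: N; exact: nbhs_infty_gt.
Unshelve. all: by end_near. Qed.

Lemma cvgr_sqrt_natr : Num.sqrt (N%:R : R) @[N --> \oo] --> +oo.
Proof. by apply/cvgryPge => A; exact: near_sqrt_ge. Qed.

Lemma cvgr_invsqrt_natr : (Num.sqrt (N%:R : R))^-1 @[N --> \oo] --> 0.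
Proof. by apply/gtr0_cvgV0; [exact: near_sqrt_gt0|exact: cvgr_sqrt_natr]. Qed.

End Sqrt.

Section LogConcave.
Variables (R : realType) (u : nat -> R) (lo hi : nat).
Hypothesis u_conc : forall m n, (lo <= m)%N -> (m <= n)%N -> (n < hi)%N ->
  u n.+1 - u n <= u m.+1 - u m.

(** A concave sequence lies below the line through its values at two consecutive
indices a and a + 1. *)
Lemma concave_tangent a m : (lo <= a < hi)%N -> (lo <= m <= hi)%N ->
  u m <= u a + (m%:R - a%:R) * (u a.+1 - u a).
Proof.
move=> /andP[la ah] /andP[lm mh]; have [am|ma] := leqP a m.
  rewrite -(subnKC am) in mh *; elim: (m - a)%N mh => [|k IH] mh.
    by rewrite addn0 subrr mul0r addr0.
  rewrite addnS in mh *.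
  have := IH (ltnW mh); have := u_conc la (leq_addr k a) mh.
  rewrite -addn1 !natrD; lra.
move/ltnW in ma; rewrite -(subKn ma); set k := (a - m)%N.
have : (k <= a - lo)%N by rewrite /k; lia.
elim: k => [|k IH] kl; first by rewrite subn0 subrr mul0r addr0.
have := IH (ltnW kl).
have lk : (lo <= a - k.+1)%N by lia.
have := u_conc lk (leq_subr _ _) ah.
have -> : (a - k.+1).+1 = (a - k)%N by lia.
rewrite !natrB ?(leq_trans kl) ?leq_subr //; last by lia.
rewrite -(natr1 k); lra.
Qed.

End LogConcave.

Lemma telescope_norm_le (R : realDomainType) (v : nat -> R) (e : R) a b : (a <= b)%N ->
  (forall m, (a <= m < b)%N -> `|v m.+1 - v m| <= e) -> `|v b - v a| <= (b - a)%:R * e.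
Proof.
move=> ab H; rewrite -telescope_sumr //.
apply: le_trans (ler_norm_sum _ _ _) _.
rewrite mulr_natl -sumr_const_nat.
by apply: ler_sum_nat => m /H.
Qed.

(** Extension by zero of a sequence to the negative integers. *)
Definition zext (R : nmodType) (f : nat -> R) (z : int) : R :=
  if z is Posz m then f m else 0.

Section StepIntegral.
Variable R : realType.
Local Notation mu := (@lebesgue_measure R).

(** The interval of those t for which the integer part of c + t q is m. *)
Let cell (c q : R) (m : nat) : set R := [set` `[(m%:R - c) / q, (m.+1%:R - c) / q[ ].

Lemma in_cell c q m t : 0 < q -> cell c q m t = (Num.floor (c + t * q) = Posz m).
Proof.
move=> q0; rewrite /cell /= in_itv /= ler_pdivrMr // ltr_pdivlMr //.
rewrite lerBlDl ltrBrDl; apply/propext; split.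
  by move=> H; apply: floor_def; rewrite -PoszD addn1 -!pmulrn.
move=> H; have := floor_itv (c + t * q).
by rewrite H -PoszD addn1 -!pmulrn.
Qed.

Lemma zext_step (f : nat -> R) (c q : R) M t : 0 < q -> (forall m, (M < m)%N -> f m = 0) ->
  zext f (Num.floor (c + t * q)) = \sum_(m < M.+1) f m * \1_(cell c q m) t.
Proof.
move=> q0 f0; have cellE m : \1_(cell c q m) t = (Num.floor (c + t * q) == Posz m)%:R :> R.
  rewrite indicE; congr (_%:R); congr nat_of_bool.
  by apply/idP/eqP; rewrite inE in_cell.
under eq_bigr do rewrite cellE.
case: (Num.floor (c + t * q)) => [k|k] /=; last by rewrite big1 // => i _; rewrite mulr0.
have [kM|Mk] := leqP k M.
  rewrite (bigD1 (Ordinal (kM : (k < M.+1)%N))) //= eqxx mulr1 big1 ?addr0 // => i ik.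
  case: eqP => [[E]|]; rewrite ?mulr0 //.
  by move/negP: ik; case; apply/eqP/val_inj.
rewrite f0 // big1 // => i _; case: eqP => [[E]|]; rewrite ?mulr0 //.
by have := ltn_ord i; rewrite -E ltnS leqNgt Mk.
Qed.

Lemma measurable_zext_step (f : nat -> R) (c q : R) M : 0 < q ->
    (forall m, (M < m)%N -> f m = 0) ->
  measurable_fun setT (fun t : R => zext f (Num.floor (c + t * q))).
Proof.
move=> q0 f0; under eq_fun do rewrite (zext_step _ _ q0 f0).
apply: measurable_sum => m; apply: measurable_funM => //.
by apply: measurable_indic; exact: measurable_itv.
Qed.

(** The step function t |-> f (floor (c + t q)) takes each value f m on an interval
of length 1 / q. *)
Lemma integral_zext_step (f : nat -> R) (c q : R) M :
    0 < q -> (forall m, (M < m)%N -> f m = 0) ->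
  (\int[mu]_t (zext f (Num.floor (c + t * q)))%:E = (q^-1 * \sum_(m < M.+1) f m)%:E)%E.
Proof.
move=> q0 f0; under eq_integral do rewrite (zext_step _ _ q0 f0) -sumEFin.
have icell m : mu (cell c q m) = (q^-1)%:E.
  rewrite /cell lebesgue_measure_itv /= lte_fin ltr_pM2r ?invr_gt0 // ltrD2r ltr_nat ltnSn.
  by rewrite -EFinB -(natr1 m); congr (_%:E); field; rewrite gt_eqF.
have mcell m : measurable (cell c q m) by exact: measurable_itv.
have iint m : (\int[mu]_t (\1_(cell c q m) t)%:E = (q^-1)%:E)%E.
  by rewrite (integral_indic mu measurableT (mcell m)) setIT; exact: icell.
have intc m : mu.-integrable setT (EFin \o \1_(cell c q m)).
  apply/integrableP; split.
    by apply/measurable_EFinP; apply: measurable_indic; exact: mcell.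
  under eq_integral do rewrite /= ger0_norm //.
  by rewrite iint ltry.
rewrite integral_sum //; last first.
  move=> m; under [X in integrable _ _ X]eq_fun do rewrite EFinM.
  by apply: integrableZl => //; exact: intc.
rewrite mulr_sumr -sumEFin; apply: eq_bigr => m _.
under eq_integral do rewrite EFinM.
rewrite integralZl //; last exact: intc.
by rewrite iint -EFinM mulrC.
Qed.

End StepIntegral.

Section Integrals.
Variable R : realType.
Local Notation mu := (@lebesgue_measure R).

(** Up to a constant factor, the restriction to the positive half-line is an
exponential density. *)
Lemma integrable_expR_norm (C c : R) : 0 < c ->
  mu.-integrable setT (fun t => (expR (C - c * `|t|))%:E).
Proof.
move=> c0.
have cont : continuous (fun t : R => expR (C - c * `|t|)).
  move=> t; apply: continuous_comp; last exact: continuous_expR.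
  apply: cvgB; first exact: cvg_cst.
  by apply: cvgM; [exact: cvg_cst|exact: norm_continuous].
have mf : measurable_fun setT (fun t : R => expR (C - c * `|t|)).
  exact: continuous_measurable_fun.
apply/integrableP; split; first exact/measurable_EFinP.
under eq_integral do rewrite /= (ger0_norm (expR_ge0 _)).
have even : (fun t : R => expR (C - c * `|t|)) =1 (fun t => expR (C - c * `|t|)) \o -%R.
  by move=> t; rewrite /= normrN.
rewrite (ge0_symfun_integralT (fun t => expR_ge0 _) cont even).
apply: lte_mul_pinfty => //.
have := @integral_exponential_pdf R c c0.
rewrite (_ : [set x | _] = `[0, +oo[%classic); last first.
  by apply/seteqP; split => x /=; rewrite in_itv /= andbT.
move=> E.
apply: (@le_lt_trans _ _
  (\int[mu]_(x in `[0%R, +oo[) ((expR C / c)%:E * (exponential_pdf c x)%:E))%E).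
  rewrite le_eqVlt; apply/orP; left; apply/eqP; apply: eq_integral => t.
  rewrite inE /= in_itv /= andbT => t0.
  rewrite exponential_pdfE //= -EFinM; congr (_%:E).
  by rewrite ger0_norm // expRD -mulNr; field; rewrite gt_eqF.
rewrite ge0_integralZl //.
- apply: lte_mul_pinfty => //.
  + by rewrite lee_fin divr_ge0 ?expR_ge0 // ltW.
  + apply: (@le_lt_trans _ _ 1%E); last exact: ltry.
    rewrite -E; apply: ge0_subset_integral => //.
      by apply/measurable_EFinP; exact: measurable_exponential_pdf.
    by move=> x _; rewrite lee_fin exponential_pdf_ge0 // ltW.
- by apply/measurable_EFinP; apply: measurable_funTS; exact: measurable_exponential_pdf.
- by move=> x _; rewrite lee_fin exponential_pdf_ge0 // ltW.
- by rewrite lee_fin divr_ge0 ?expR_ge0 // ltW.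
Qed.

Lemma integral_expR_sqr (s : R) : 0 < s ->
  (\int[mu]_t (expR (- s / 2 * t ^+ 2))%:E = (Num.sqrt (2 * pi / s))%:E)%E.
Proof.
move=> s0.
have v0 : (Num.sqrt s)^-1 != 0 by rewrite invr_eq0 gt_eqF // sqrtr_gt0.
have E t : expR (- s / 2 * t ^+ 2) = Num.sqrt (2 * pi / s) * normal_pdf 0 (Num.sqrt s)^-1 t.
  rewrite (normal_pdfE _ v0) /normal_peak /normal_fun subr0 exprVn sqr_sqrtr ?(ltW s0) //.
  have -> : s^-1 * pi *+ 2 = 2 * pi / s by ring.
  rewrite [RHS]mulrA divff ?mul1r; first by congr expR; field; rewrite gt_eqF.
  by rewrite gt_eqF // sqrtr_gt0 divr_gt0 // mulr_gt0 // pi_gt0.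
under eq_integral do rewrite E EFinM.
by rewrite integralZl ?integral_normal_pdf ?mule1 //; exact: integrable_normal_pdf.
Qed.

End Integrals.

(** * A local limit theorem for log-concave laws *)

(** For each N, p N is a probability law on the naturals with support between lo N
and hi N.  For N large it is log-concave, and its logarithmic increments are
- s (m - h N) / N up to o(1 / sqrt N), uniformly at distance O(sqrt N) from h N. *)
Section LocalLimit.
Variables (R : realType) (p : nat -> nat -> R) (lo hi : nat -> nat) (h s : R).
Hypotheses (h0 : 0 < h) (s0 : 0 < s).
Local Notation d N m := (ln (p N m.+1) - ln (p N m)).
Hypothesis p_gt0 : \forall N \near \oo, forall m, (lo N <= m <= hi N)%N -> 0 < p N m.
Hypothesis p_out : \forall N \near \oo, forall m, ~~ (lo N <= m <= hi N)%N -> p N m = 0.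
Hypothesis p_conc : \forall N \near \oo, forall m n,
  (lo N <= m)%N -> (m <= n)%N -> (n < hi N)%N -> d N n <= d N m.
Hypothesis p_sum : \forall N \near \oo, \sum_(m < (hi N).+1) p N m = 1.
Hypothesis p_slope : forall T e : R, 0 < e -> \forall N \near \oo, forall m : nat,
  `|m%:R - h * N%:R| <= T * Num.sqrt N%:R ->
  (lo N <= m < hi N)%N /\ `|d N m + s * ((m%:R - h * N%:R) / N%:R)| <= e / Num.sqrt N%:R.

(** The point at distance t sqrt N from the centre h N, and its integer part. *)
Let pos N (t : R) : R := h * N%:R + t * Num.sqrt N%:R.
Let site N t := Num.truncn (pos N t).

Lemma near_pos_ge0 t : \forall N \near \oo, 0 <= pos N t.
Proof.
near=> N.
have -> : pos N t = Num.sqrt N%:R * (h * Num.sqrt N%:R + t).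
  by rewrite /pos -[X in h * X](@sqr_sqrtr _ N%:R) // expr2; ring.
rewrite mulr_ge0 ?sqrtr_ge0 // -lerBlDr sub0r mulrC -ler_pdivrMr //.
by near: N; exact: near_sqrt_ge.
Unshelve. all: by end_near. Qed.

Lemma near_site t : \forall N \near \oo,
  0 < Num.sqrt N%:R :> R /\ (site N t)%:R <= pos N t < (site N t)%:R + 1.
Proof.
near=> N; split; first by near: N; exact: near_sqrt_gt0.
have := @truncn_itv R (pos N t); rewrite -natr1; apply.
by near: N; exact: near_pos_ge0.
Unshelve. all: by end_near. Qed.

Lemma site_cvg t : ((site N t)%:R - h * N%:R) / Num.sqrt N%:R @[N --> \oo] --> t.
Proof.
apply/cvgrPdist_le => e e0; near=> N.
have [q0 H] : 0 < Num.sqrt N%:R :> R /\ (site N t)%:R <= pos N t < (site N t)%:R + 1.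
  by near: N; exact: near_site.
have -> : t - ((site N t)%:R - h * N%:R) / Num.sqrt N%:R =
   (pos N t - (site N t)%:R) / Num.sqrt N%:R.
  by rewrite /pos; field; rewrite gt_eqF.
rewrite normrM normfV (ger0_norm (sqrtr_ge0 _)).
have qe : (Num.sqrt N%:R)^-1 <= e.
  by near: N; exact: near_invsqrt_le.
apply: le_trans qe; rewrite ler_piMl ?invr_ge0 ?sqrtr_ge0 //.
rewrite ler_norml; lra.
Unshelve. all: by end_near. Qed.

Lemma near_window t : \forall N \near \oo,
  `|(site N t)%:R - h * N%:R| <= (`|t| + 1) * Num.sqrt N%:R.
Proof.
have := cvgr_norm_le _ (@site_cvg t) (`|t| + 1); rewrite ltrDl ltr01 => /(_ _ isT) H.
near=> N.
have q0 : 0 < Num.sqrt N%:R :> R by near: N; exact: near_sqrt_gt0.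
rewrite -ler_pdivrMr // -[X in _ / X](ger0_norm (ltW q0)) -normfV -normrM.
by near: N.
Unshelve. all: by end_near. Qed.

Lemma near_slope t e : 0 < e -> \forall N \near \oo,
  (lo N <= site N t < hi N)%N /\
  `|d N (site N t) + s * (((site N t)%:R - h * N%:R) / N%:R)| <= e / Num.sqrt N%:R.
Proof.
move=> e0; near=> N.
have : `|(site N t)%:R - h * N%:R| <= (`|t| + 1) * Num.sqrt N%:R.
  by near: N; exact: near_window.
by move: (site N t); near: N; exact: p_slope.
Unshelve. all: by end_near. Qed.

Lemma near_site_in t : \forall N \near \oo,
  (lo N <= site N t < hi N)%N /\ 0 < p N (site N t).
Proof.
near=> N.
have P : forall m, (lo N <= m <= hi N)%N -> 0 < p N m by near: N.
have [/andP[l1 h1] _] : (lo N <= site N t < hi N)%N /\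
  `|d N (site N t) + s * (((site N t)%:R - h * N%:R) / N%:R)| <= 1 / Num.sqrt N%:R.
  by near: N; exact: near_slope.
by rewrite l1 h1 P // l1 ltnW.
Unshelve. all: by end_near. Qed.

Lemma slope_cvg t : Num.sqrt N%:R * d N (site N t) @[N --> \oo] --> - s * t.
Proof.
have H : Num.sqrt N%:R * d N (site N t) + s * (((site N t)%:R - h * N%:R) / Num.sqrt N%:R)
   @[N --> \oo] --> 0.
  apply/cvgr0Pnorm_le => e e0; near=> N.
  have q0 : 0 < Num.sqrt N%:R :> R by near: N; exact: near_sqrt_gt0.
  have [_] : (lo N <= site N t < hi N)%N /\
     `|d N (site N t) + s * (((site N t)%:R - h * N%:R) / N%:R)| <= e / Num.sqrt N%:R.
    by near: N; exact: near_slope.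
  rewrite ler_pdivlMr //; apply: le_trans.
  rewrite -[X in _ <= _ * X](ger0_norm (ltW q0)) -normrM.
  rewrite le_eqVlt; apply/orP; left; apply/eqP; congr (`| _ |).
  have := @sqr_sqrtr R N%:R (ler0n _ _).
  by move: (Num.sqrt N%:R) q0 => q q0 <-; field; rewrite gt_eqF.
rewrite mulNr -sub0r; apply: cvg_near_eq (cvgB H (cvgM (cvg_cst s) (@site_cvg t))).
by apply: nearW => N /=; rewrite addrK.
Unshelve. all: by end_near. Qed.

(* Near the centre, this sum of ln p and the opposite of the limiting quadratic
   profile has increments o(1 / sqrt N). *)
Let V N m := ln (p N m) + s * (m%:R - h * N%:R) ^+ 2 / (2 * N%:R).

(** There are about (b - a) sqrt N increments of V between the two sites, each
o(1 / sqrt N). *)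
Lemma logp_diff_cvg a b : a <= b ->
  ln (p N (site N b)) - ln (p N (site N a)) @[N --> \oo] --> - s / 2 * (b ^+ 2 - a ^+ 2).
Proof.
move=> ab.
have site_le N : (site N a <= site N b)%N.
  by apply: le_truncn; rewrite lerD2l ler_wpM2r ?sqrtr_ge0.
have H : V N (site N b) - V N (site N a) @[N --> \oo] --> 0.
  apply/cvgr0Pnorm_le => e e0.
  (* The sum has at most (b - a + 1) sqrt N terms, each at most 2 e' / sqrt N. *)
  pose e' := e / (2 * (b - a + 1)).
  have e'0 : 0 < e' by rewrite divr_gt0 // mulr_gt0 //; lra.
  pose T := Num.max (`|a| + 1) (`|b| + 1).
  have PS := @p_slope T _ e'0.
  near=> N.
  have [q0 /andP[pa pa']] : 0 < Num.sqrt N%:R :> R /\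
      (site N a)%:R <= pos N a < (site N a)%:R + 1.
    by near: N; exact: near_site.
  have [_ /andP[pb pb']] : 0 < Num.sqrt N%:R :> R /\
      (site N b)%:R <= pos N b < (site N b)%:R + 1.
    by near: N; exact: near_site.
  have q1 : 1 <= Num.sqrt N%:R :> R by near: N; exact: near_sqrt_ge.
  have wa : `|(site N a)%:R - h * N%:R| <= T * Num.sqrt N%:R.
    apply: (@le_trans _ _ ((`|a| + 1) * Num.sqrt N%:R)).
      by near: N; exact: near_window.
    by rewrite ler_wpM2r ?sqrtr_ge0 // le_max lexx.
  have wb : `|(site N b)%:R - h * N%:R| <= T * Num.sqrt N%:R.
    apply: (@le_trans _ _ ((`|b| + 1) * Num.sqrt N%:R)).
      by near: N; exact: near_window.
    by rewrite ler_wpM2r ?sqrtr_ge0 // le_max lexx orbT.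
  have sq : s / 2 / Num.sqrt N%:R <= e'.
    rewrite ler_pdivrMr // -ler_pdivrMl //.
    by near: N; exact: near_sqrt_ge.
  have qN := @sqr_sqrtr R N%:R (ler0n _ _).
  have step m : (site N a <= m < site N b)%N -> `|V N m.+1 - V N m| <= 2 * e' / Num.sqrt N%:R.
    move=> /andP[am mb].
    have : `|m%:R - h * N%:R| <= T * Num.sqrt N%:R.
      rewrite ler_norml; move: wa wb; rewrite !ler_norml => /andP[wa _] /andP[_ wb].
      apply/andP; split; [apply: le_trans wa _|apply: le_trans wb]; rewrite lerD2r ler_nat //.
      exact: ltnW.
    move=> wm.
    have [_ D] : (lo N <= m < hi N)%N /\
        `|d N m + s * ((m%:R - h * N%:R) / N%:R)| <= e' / Num.sqrt N%:R.
      by move: m wm {am mb}; near: N; exact: PS.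
    have -> : V N m.+1 - V N m = d N m + s * ((m%:R - h * N%:R) / N%:R)
        + s / 2 / Num.sqrt N%:R / Num.sqrt N%:R.
      rewrite /V -(natr1 m); move: (Num.sqrt N%:R) q0 qN => q q0 <-.
      by field; rewrite gt_eqF.
    apply: le_trans (ler_normD _ _) _.
    have -> : 2 * e' / Num.sqrt N%:R = e' / Num.sqrt N%:R + e' / Num.sqrt N%:R by ring.
    apply: lerD => //; rewrite ger0_norm ?divr_ge0 ?sqrtr_ge0 //; last exact: ltW.
    by rewrite ler_wpM2r // invr_ge0 sqrtr_ge0.
  apply: le_trans (telescope_norm_le (site_le N) step) _.
  rewrite natrB // mulrA ler_pdivrMr //.
  have -> : e * Num.sqrt N%:R = 2 * e' * ((b - a + 1) * Num.sqrt N%:R).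
    by rewrite /e'; field; rewrite gt_eqF //; lra.
  have e2 : 0 <= 2 * e' by lra.
  rewrite mulrC; apply: ler_wpM2l => //.
  apply: (@le_trans _ _ (pos N b - pos N a + 1)); first by lra.
  rewrite /pos; nra.
have site_sqr t : ((site N t)%:R - h * N%:R) ^+ 2 / N%:R @[N --> \oo] --> t ^+ 2.
  rewrite expr2; apply: cvg_near_eq (cvgM (@site_cvg t) (@site_cvg t)).
  by apply: nearW => N /=; rewrite -expr2 exprMn exprVn sqr_sqrtr.
rewrite !mulNr -sub0r.
apply: cvg_near_eq (cvgB H (cvgM (cvg_cst (s / 2)) (cvgB (site_sqr b) (site_sqr a)))).
near=> N.
have N0 : N%:R != 0 :> R by rewrite pnatr_eq0 -lt0n; near: N; exact: nbhs_infty_gt.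
by rewrite /V !fctE /=; field.
Unshelve. all: by end_near. Qed.

(** The probability at the integer part of pos N t, zero if that is negative. *)
Let prof N t := zext (p N) (Num.floor (pos N t)).

Lemma near_prof t : \forall N \near \oo, prof N t = p N (site N t).
Proof.
near=> N; rewrite /prof /site truncEfloor.
have : 0 <= pos N t by near: N; exact: near_pos_ge0.
by rewrite -floor_ge0; case: (Num.floor _).
Unshelve. all: by end_near. Qed.

Lemma lnp_diff0_cvg t :
  ln (p N (site N t)) - ln (p N (site N 0)) @[N --> \oo] --> - s / 2 * t ^+ 2.
Proof.
have [t0|t0] := leP 0 t.
  by have := logp_diff_cvg t0; rewrite expr0n /= subr0.
have := cvgN (logp_diff_cvg (ltW t0)).
rewrite expr0n /= sub0r mulrN opprK => HH; apply: cvg_near_eq (HH _).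
by apply: nearW => N; rewrite !fctE opprB.
Qed.

Lemma ratio_cvg t : prof N t / p N (site N 0) @[N --> \oo] --> expR (- s / 2 * t ^+ 2).
Proof.
apply: cvg_near_eq (cvg_comp _ _ (@lnp_diff0_cvg t) (@continuous_expR R _)).
near=> N.
have -> : prof N t = p N (site N t) by near: N; exact: near_prof.
have [_ p00] : (lo N <= site N 0 < hi N)%N /\ 0 < p N (site N 0).
  by near: N; exact: near_site_in.
have [_ pt0] : (lo N <= site N t < hi N)%N /\ 0 < p N (site N t).
  by near: N; exact: near_site_in.
by rewrite /= expRB !lnK // posrE.
Unshelve. all: by end_near. Qed.

Lemma near_lnp_le t : \forall N \near \oo,
  ln (p N (site N t)) - ln (p N (site N 0)) <= 1.
Proof.
have := cvgr_le _ (@lnp_diff0_cvg t) 1; apply.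
by have := sqr_ge0 t; have := s0; nra.
Qed.

(** The tangent of ln p at site N 1 bounds the profile for t >= 0, and the one at
site N (-1) bounds it for t < 0: their slopes are about - s / sqrt N and
s / sqrt N.  The constants are not sharp. *)
Lemma near_prof_le : \forall N \near \oo, forall t,
  0 <= prof N t / p N (site N 0) <= expR (1 + 5 * s - s / 2 * `|t|).
Proof.
have s2 : 0 < s / 2 by rewrite divr_gt0.
have /cvgrPdist_le/(_ _ s2) S1 := @slope_cvg 1.
have /cvgrPdist_le/(_ _ s2) S2 := @slope_cvg (-1).
near=> N.
have q1 : 1 <= Num.sqrt N%:R :> R by near: N; exact: near_sqrt_ge.
have q0 : 0 < Num.sqrt N%:R :> R by lra.
have P : forall m, (lo N <= m <= hi N)%N -> 0 < p N m by near: N.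
have O : forall m, ~~ (lo N <= m <= hi N)%N -> p N m = 0 by near: N.
have C : forall m n, (lo N <= m)%N -> (m <= n)%N -> (n < hi N)%N -> d N n <= d N m by near: N.
have [_ p00] : (lo N <= site N 0 < hi N)%N /\ 0 < p N (site N 0).
  by near: N; exact: near_site_in.
have [i1 _] : (lo N <= site N 1 < hi N)%N /\ 0 < p N (site N 1).
  by near: N; exact: near_site_in.
have [i2 _] : (lo N <= site N (-1) < hi N)%N /\ 0 < p N (site N (-1)).
  by near: N; exact: near_site_in.
have e1 : ln (p N (site N 1)) - ln (p N (site N 0)) <= 1 by near: N; exact: near_lnp_le.
have e2 : ln (p N (site N (-1))) - ln (p N (site N 0)) <= 1 by near: N; exact: near_lnp_le.
have [_ /andP[p1 p1']] : 0 < Num.sqrt N%:R :> R /\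
    (site N 1)%:R <= pos N 1 < (site N 1)%:R + 1.
  by near: N; exact: near_site.
have [_ /andP[p2 p2']] : 0 < Num.sqrt N%:R :> R /\
    (site N (-1))%:R <= pos N (-1) < (site N (-1))%:R + 1.
  by near: N; exact: near_site.
have d1 : `|- s * 1 - Num.sqrt N%:R * d N (site N 1)| <= s / 2 by near: N.
have d2 : `|- s * -1 - Num.sqrt N%:R * d N (site N (-1))| <= s / 2 by near: N.
move=> t.
rewrite /prof; case E : (Num.floor (pos N t)) => [m|m] /=; last by rewrite mul0r lexx expR_ge0.
have /andP[pm pm'] : m%:R <= pos N t < m%:R + 1.
  by have := floor_itv (pos N t); rewrite E -PoszD addn1 -!pmulrn natr1.
have [im|/O->] := boolP (lo N <= m <= hi N)%N; last by rewrite mul0r lexx expR_ge0.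
have pm0 := P m im.
rewrite divr_ge0 ?(ltW pm0) ?(ltW p00) //= -[p N m]lnK ?posrE // -[X in _ / X]lnK ?posrE //.
rewrite -expRB ler_expR.
have tangent := @concave_tangent R (fun m => ln (p N m)) (lo N) (hi N) C.
have [t0|t0] := leP 0 t.
  have := tangent (site N 1) m i1 im; rewrite /=.
  (* x is within 1 of t - 1, and the rescaled slope D lies between -3s/2 and -s/2. *)
  pose x : R := (m%:R - (site N 1)%:R) / Num.sqrt N%:R.
  have -> : (m%:R - (site N 1)%:R) * d N (site N 1) = x * (Num.sqrt N%:R * d N (site N 1)).
    by rewrite /x; field; rewrite gt_eqF.
  have x1 : t - 2 <= x.
    rewrite /x ler_pdivlMr //; move: p1 p1' pm pm'; rewrite /pos; nra.
  move: d1; rewrite ler_norml; move: (Num.sqrt _ * _) => D /andP[D1 D2].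
  rewrite ger0_norm //.
  have : x * D <= 5 * s - s / 2 * t.
    have [x0|x0] := leP 0 x; nra.
  lra.
have := tangent (site N (-1)) m i2 im; rewrite /=.
pose x : R := (m%:R - (site N (-1))%:R) / Num.sqrt N%:R.
have -> : (m%:R - (site N (-1))%:R) * d N (site N (-1)) = x * (Num.sqrt N%:R * d N (site N (-1))).
  by rewrite /x; field; rewrite gt_eqF.
have x1 : x <= t + 2.
  rewrite /x ler_pdivrMr //; move: p2 p2' pm pm'; rewrite /pos; nra.
move: d2; rewrite ler_norml; move: (Num.sqrt _ * _) => D /andP[D1 D2].
rewrite ltr0_norm //.
have : x * D <= 5 * s + s / 2 * t.
  have [x0|x0] := leP 0 x; nra.
lra.
Unshelve. all: by end_near. Qed.

(** The integral of the profile, normalized at the centre, is the left-hand side. *)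
Lemma mass_cvg :
  (Num.sqrt N%:R * p N (site N 0))^-1 @[N --> \oo] --> Num.sqrt (2 * pi / s).
Proof.
have s2 : 0 < s / 2 by rewrite divr_gt0.
have near_all : \forall N \near \oo,
  [/\ 0 < Num.sqrt N%:R :> R, 0 < p N (site N 0),
      forall m, ~~ (lo N <= m <= hi N)%N -> p N m = 0,
      \sum_(m < (hi N).+1) p N m = 1 &
      forall t, 0 <= prof N t / p N (site N 0) <= expR (1 + 5 * s - s / 2 * `|t|)].
  near=> N; split.
  - by near: N; exact: near_sqrt_gt0.
  - by apply: (proj2 (A := (lo N <= site N 0 < hi N)%N)); near: N; exact: near_site_in.
  - by near: N.
  - by near: N.
  - by near: N; exact: near_prof_le.
have [N0 _ allN0] := near_all.
(* Dominated convergence needs a domination for all indices, hence the shift by N0. *)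
pose G n t := prof (n + N0) t / p (n + N0)%N (site (n + N0) 0).
have GE n : (\int[@lebesgue_measure R]_t (G n t)%:E =
    ((Num.sqrt (n + N0)%:R * p (n + N0)%N (site (n + N0) 0))^-1)%:E)%E.
  have [|q0 p0 po p1 _] := allN0 (n + N0)%N; first by rewrite /= leq_addl.
  pose f m := p (n + N0)%N m / p (n + N0)%N (site (n + N0) 0).
  have f0 m : (hi (n + N0) < m)%N -> f m = 0.
    by move=> hm; rewrite /f po ?mul0r // negb_and -!ltnNge hm orbT.
  rewrite (_ : (_ * _)^-1 = (Num.sqrt (n + N0)%:R)^-1 * \sum_(m < (hi (n + N0)).+1) f m).
    rewrite -(integral_zext_step (h * (n + N0)%:R) q0 f0).
    apply: eq_integral => t _; congr (_%:E).
    by rewrite /G /prof /pos /f; case: (Num.floor _) => //= _; rewrite mul0r.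
  by rewrite -mulr_suml p1 mul1r invfM.
have D := @dominated_cvg _ _ R (@lebesgue_measure R) setT measurableT (fun n t => (G n t)%:E)
  (fun t => (expR (- s / 2 * t ^+ 2))%:E) (fun t => (expR (1 + 5 * s - s / 2 * `|t|))%:E).
have /= {}D : (\int[@lebesgue_measure R]_t (G n t)%:E)%E @[n --> \oo] -->
    (\int[@lebesgue_measure R]_t (expR (- s / 2 * t ^+ 2))%:E)%E.
  apply: D => //.
  - move=> n; apply/measurable_EFinP; apply: measurable_funM => //.
    have [|q0 p0 po p1 _] := allN0 (n + N0)%N; first by rewrite /= leq_addl.
    apply: (@measurable_zext_step _ _ _ _ (hi (n + N0))) => // m hm.
    by rewrite po // negb_and -!ltnNge hm orbT.
  - move=> t _; apply/cvg_EFin; first by near=> n.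
    by have := @ratio_cvg t; rewrite -(cvg_shiftn N0).
  - exact: integrable_expR_norm.
  - move=> n t _; have [|_ _ _ _ /(_ t) /andP[G0 G1]] := allN0 (n + N0)%N.
      by rewrite /= leq_addl.
    by rewrite /= lee_fin ger0_norm.
have {}D : ((Num.sqrt (n + N0)%:R * p (n + N0)%N (site (n + N0) 0))^-1)%:E @[n --> \oo]
    --> (Num.sqrt (2 * pi / s))%:E.
  by move: D; rewrite integral_expR_sqr //; under eq_fun do rewrite GE.
rewrite -(@cvg_shiftn N0 R); exact: (fine_cvg D).
Unshelve. all: by end_near. Qed.

(** The limit is the density at t of the centred Gaussian law of variance 1 / s. *)
Lemma log_concave_local_limit t :
  Num.sqrt N%:R * zext (p N) (Num.floor (h * N%:R + t * Num.sqrt N%:R)) @[N --> \oo]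
  --> expR (- s / 2 * t ^+ 2) / Num.sqrt (2 * pi / s).
Proof.
have c0 : Num.sqrt (2 * pi / s) != 0.
  by rewrite gt_eqF // sqrtr_gt0 divr_gt0 // mulr_gt0 // pi_gt0.
apply: cvg_near_eq (cvgM (@ratio_cvg t) (cvgV c0 mass_cvg)).
near=> N; rewrite /= ?fctE invrK.
have p00 : p N (site N 0) != 0.
  have [_ p0] : (lo N <= site N 0 < hi N)%N /\ 0 < p N (site N 0).
    by near: N; exact: near_site_in.
  by rewrite gt_eqF.
by rewrite /prof /pos; field.
Unshelve. all: by end_near. Qed.

End LocalLimit.

(** * Ratios of the q-hypergeometric law *)

Section Hypergeometric.
Variables (R : realType) (q : R) (N L K : nat).
Hypotheses (q01 : 0 < q < 1) (LN : (L <= N)%N) (KN : (K <= N)%N).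
Local Notation p m := (mallows_prob q (fun w : 'S_N => height L K w == m)).

Lemma height_lek (w : 'S_N) : (height L K w <= K)%N.
Proof.
rewrite /height card_sum_ord -[leqRHS](sum_ltn_ord KN).
rewrite [leqRHS](reindex_inj (@perm_inj _ w)).
by apply: leq_sum => i _; case: (i < L)%N.
Qed.

Lemma mallows_height_gt0 m : (L + K - N <= m <= minn L K)%N -> 0 < p m.
Proof.
rewrite leq_min => /andP[lm /andP[mL mK]].
rewrite -(pmulr_rgt0 _ (qbinom_gt0 q01 LN)) (mallows_height q01) //.
case/andP: q01 => q0 _.
by rewrite !mulr_gt0 ?exprn_gt0 // qbinom_gt0 //; lia.
Qed.

Lemma mallows_height_out m : ~~ (L + K - N <= m <= minn L K)%N -> p m = 0.
Proof.
move=> out; have [mh|hm] := leqP m (minn L K); last first.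
  rewrite /mallows_prob big_pred0 // => w; apply/negP => /eqP wm.
  by move: hm; rewrite -wm ltnNge leq_min height_le // height_lek.
have qN0 : qbinom q N L != 0 by rewrite gt_eqF // qbinom_gt0.
apply: (mulfI qN0).
rewrite (mallows_height q01) ?mulr0 //; last by move: mh; rewrite leq_min => /andP[].
rewrite [qbinom _ (N - K) _]qbinom_gtn ?mulr0 ?mul0r //.
by move: mh out; rewrite leq_min; lia.
Qed.

Lemma mallows_height_sum : \sum_(m < (minn L K).+1) p m = 1.
Proof.
rewrite -(mallows_total q01 N) /mallows_prob.
rewrite [RHS](partition_big (fun w => inord (height L K w) : 'I_(minn L K).+1) xpredT) //=.
apply: eq_bigr => m _; apply: eq_bigl => w.
by rewrite -val_eqE /= inordK // ltnS leq_min height_le // height_lek.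
Qed.

(** The ratio of two consecutive probabilities, cleared of denominators. *)
Lemma mallows_height_step m : (L + K - N <= m < minn L K)%N ->
  p m.+1 * ((1 - q ^+ m.+1) * (1 - q ^+ (N + m.+1 - (L + K))) * q ^+ ((L - m) + (K - m))) =
  p m * ((1 - q ^+ (L - m)) * (1 - q ^+ (K - m)) * q).
Proof.
rewrite leq_min => /andP[lm /andP[mL mK]].
have qN0 : qbinom q N L != 0 by rewrite gt_eqF // qbinom_gt0.
apply: (mulfI qN0); rewrite [LHS]mulrA [RHS]mulrA !(mallows_height q01) ?(ltnW mL) //.
have E1 := qbinom_recr q01 mK.
have lNK : (L - m.+1 < N - K)%N by lia.
have := qbinom_recr q01 lNK.
have -> : ((L - m.+1).+1 = L - m)%N by lia.
have -> : (N - K - (L - m.+1) = N + m.+1 - (L + K))%N by lia.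
move=> E2.
have E3 : q ^+ ((L - m.+1) * (K - m.+1)) * q ^+ (L - m + (K - m)) =
    q ^+ ((L - m) * (K - m)) * q.
  rewrite -exprD -exprSr; congr (_ ^+ _).
  have [a aE] : exists a, (L - m = a.+1)%N by exists (L - m).-1; lia.
  have [b bE] : exists b, (K - m = b.+1)%N by exists (K - m).-1; lia.
  have -> : (L - m.+1 = a)%N by lia.
  have -> : (K - m.+1 = b)%N by lia.
  rewrite aE bE; lia.
transitivity ((1 - q ^+ m.+1) * qbinom q K m.+1 *
  ((1 - q ^+ (N + m.+1 - (L + K))) * qbinom q (N - K) (L - m.+1)) *
  (q ^+ ((L - m.+1) * (K - m.+1)) * q ^+ (L - m + (K - m)))).
  move: (q ^+ _) (q ^+ _) (q ^+ _) (q ^+ _) (qbinom _ _ _) (qbinom _ _ _) => *; ring.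
rewrite E1 -E2 E3.
move: (q ^+ _) (q ^+ _) (q ^+ _) (qbinom _ _ _) (qbinom _ _ _) => *; ring.
Qed.

End Hypergeometric.

Section LogRatio.
Variable R : realType.

(** The function ln (1 - e^(-v)): if q = e^(-tau), then ln (1 - q^n) is its value at
tau n. *)
Definition lnm (v : R) : R := ln (1 - expR (- v)).

Lemma subr1_expRN_gt0 (v : R) : 0 < v -> 0 < 1 - expR (- v).
Proof. by move=> v0; rewrite subr_gt0 expR_lt1 oppr_lt0. Qed.

Lemma ler_lnm (v w : R) : 0 < v -> v <= w -> lnm v <= lnm w.
Proof.
move=> v0 vw; rewrite ler_ln ?posrE ?subr1_expRN_gt0 ?(lt_le_trans v0) //.
by rewrite lerB // ler_expR lerN2.
Qed.

Lemma is_derive_lnm (v : R) : 0 < v ->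
  is_derive v 1 lnm (expR (- v) / (1 - expR (- v))).
Proof.
move=> v0.
have D : is_derive v 1 (cst 1 - (@expR R \o -%R)) (0 - expR (- v) * -1).
  apply: is_deriveB; apply: is_derive1_comp.
have L : is_derive (1 - expR (- v)) 1 (@ln R) (1 - expR (- v))^-1.
  by apply: is_derive1_ln; exact: subr1_expRN_gt0.
have := @is_derive1_comp _ (@ln R) (cst 1 - (@expR R \o -%R)) v _ _ L D.
by rewrite sub0r mulrN1 opprK mulrC.
Qed.

Lemma is_derive_id_lnm (v : R) : 0 < v ->
  is_derive v 1 (fun v => v + lnm v) (1 - expR (- v))^-1.
Proof.
move=> v0; have D := is_derive_lnm v0.
have -> : (1 - expR (- v))^-1 = 1 + expR (- v) / (1 - expR (- v)).
  by field; rewrite gt_eqF // subr1_expRN_gt0.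
exact: (is_deriveD (f := id)).
Qed.

Lemma exprn_expRN (tau : R) n : expR (- tau) ^+ n = expR (- (tau * n%:R)).
Proof. by rewrite -expRM_natl mulrN mulrC. Qed.

(** The logarithm of the ratio P(m+1) / P(m) for q = e^(-tau), as a function of real
arguments.  The terms tau (L - m), tau (K - m) and - tau come from the power of q. *)
Definition logratio (tau N L K m : R) : R :=
  (tau * (L - m) + lnm (tau * (L - m))) + (tau * (K - m) + lnm (tau * (K - m)))
  - tau - lnm (tau * (m + 1)) - lnm (tau * (N - L - K + m + 1)).

Lemma ln_mallows_height_step (tau : R) (N L K m : nat) : 0 < tau ->
  (L <= N)%N -> (K <= N)%N -> (L + K - N <= m < minn L K)%N ->
  ln (mallows_prob (expR (- tau)) (fun w : 'S_N => height L K w == m.+1)) -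
  ln (mallows_prob (expR (- tau)) (fun w : 'S_N => height L K w == m)) =
  logratio tau N%:R L%:R K%:R m%:R.
Proof.
move=> tau0 LN KN mi.
have q01 : 0 < expR (- tau) < 1 by rewrite expR_gt0 expR_lt1 oppr_lt0.
have := mallows_height_step q01 LN KN mi.
have /(mallows_height_gt0 q01 LN KN) : (L + K - N <= m <= minn L K)%N by lia.
have /(mallows_height_gt0 q01 LN KN) : (L + K - N <= m.+1 <= minn L K)%N by lia.
move: (mallows_prob _ _) (mallows_prob _ _) => p1 p0 p1_gt0 p0_gt0 E.
move: mi; rewrite leq_min => /andP[lm /andP[mL mK]].
have a1 : 0 < 1 - expR (- tau) ^+ m.+1 by rewrite subr_qpow_gt0.
have a2 : 0 < 1 - expR (- tau) ^+ (N + m.+1 - (L + K)) by rewrite subr_qpow_gt0 //; lia.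
have a3 : 0 < 1 - expR (- tau) ^+ (L - m) by rewrite subr_qpow_gt0 //; lia.
have a4 : 0 < 1 - expR (- tau) ^+ (K - m) by rewrite subr_qpow_gt0 //; lia.
have a5 : 0 < expR (- tau) ^+ (L - m + (K - m)) by rewrite exprn_gt0 // expR_gt0.
have lnq : ln (expR (- tau)) = - tau by exact: expRK.
have lnqn n : ln (expR (- tau) ^+ n) = - (tau * n%:R).
  by rewrite exprn_expRN; exact: expRK.
have := congr1 (@ln R) E.
rewrite !lnM ?posrE ?mulr_gt0 ?expR_gt0 //.
rewrite lnq lnqn !exprn_expRN /logratio /lnm.
rewrite natrB; last by lia.
rewrite !natrD (natrB _ (ltnW mL)) (natrB _ (ltnW mK)) -(natr1 m).
have -> : N%:R + (m%:R + 1) - (L%:R + K%:R) = N%:R - L%:R - K%:R + m%:R + 1 :> R by ring.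
move: (ln _) (ln _) (ln _) (ln _) (ln _) (ln _) => *; lra.
Qed.

Lemma logratio_anti (tau N L K m m' : R) : 0 < tau -> 0 <= m -> m <= m' ->
  m' < L -> m' < K -> L + K < N + m + 1 ->
  logratio tau N L K m' <= logratio tau N L K m.
Proof.
move=> t0 m0 mm mL mK mN; rewrite /logratio.
have H1 : lnm (tau * (L - m')) <= lnm (tau * (L - m)) by apply: ler_lnm; nra.
have H2 : lnm (tau * (K - m')) <= lnm (tau * (K - m)) by apply: ler_lnm; nra.
have H3 : lnm (tau * (m + 1)) <= lnm (tau * (m' + 1)) by apply: ler_lnm; nra.
have H4 : lnm (tau * (N - L - K + m + 1)) <= lnm (tau * (N - L - K + m' + 1)).
  by apply: ler_lnm; nra.
nra.
Qed.

End LogRatio.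

(** * The functions h_beta and sigma_beta *)

Section Profile.
Variables (R : realType) (beta x y : R).
Hypotheses (beta0 : 0 < beta) (hx : 0 < x < 1) (hy : 0 < y < 1).
Local Notation h := (h_beta beta x y).
Local Notation E := (expR (- beta)).
Local Notation X := (expR (- (beta * x))).
Local Notation Y := (expR (- (beta * y))).
Local Notation H := (expR (- (beta * h))).

Let ranges : [/\ 0 < E, E < X < 1 & E < Y < 1].
Proof.
move: hx hy => /andP[x0 x1] /andP[y0 y1].
split; rewrite ?expR_gt0 // ltr_expR expR_lt1 ltrN2 oppr_lt0 gtr_pMr // ?x1 ?y1.
  by rewrite mulr_gt0.
by rewrite mulr_gt0.
Qed.

Lemma expR_h_beta : (1 - E) * H = X + Y - X * Y - E.
Proof.
have [E0 /andP[EX X1] /andP[EY Y1]] := ranges.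
have -> : h = beta^-1 * (ln (1 - E) - ln (X + Y - X * Y - E)).
  by rewrite /h_beta !mulNr [beta * (x + y)]mulrDr [- (_ + _)]opprD expRD.
rewrite mulVKf ?gt_eqF // opprB.
have D0 : 0 < X + Y - X * Y - E by nra.
have N0 : 0 < 1 - E by lra.
rewrite expRB !lnK ?posrE //.
by field; rewrite gt_eqF.
Qed.

Lemma h_beta_bounds : [/\ 0 < h, h < x, h < y & 0 < 1 - x - y + h].
Proof.
have [E0 /andP[EX X1] /andP[EY Y1]] := ranges.
have := expR_h_beta; have H0 : 0 < H := expR_gt0 _; move=> EH.
have E1 : 0 < 1 - E by lra.
have mono u v : expR (- (beta * u)) < expR (- (beta * v)) -> v < u.
  by rewrite ltr_expR ltrN2 ltr_pM2l.
split.
- by apply: mono; rewrite mulr0 oppr0 expR0; nra.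
- by apply: mono; nra.
- by apply: mono; nra.
- have : x + y < 1 + h; last lra.
  apply: mono; rewrite !mulrDr !opprD !expRD mulr1; nra.
Qed.

Local Notation a := (expR (- (beta * (x - h)))).
Local Notation b := (expR (- (beta * (y - h)))).
Local Notation d := (expR (- (beta * (1 - x - y + h)))).

(** The limiting ratio of consecutive probabilities is 1 at h_beta: this is what
determines h_beta. *)
Lemma h_beta_critical : (1 - a) * (1 - b) = a * b * ((1 - H) * (1 - d)).
Proof.
have H0 : 0 < H := expR_gt0 _.
have X0 : 0 < X := expR_gt0 _.
have Y0 : 0 < Y := expR_gt0 _.
have -> : a = X / H by rewrite -expRB; congr expR; ring.
have -> : b = Y / H by rewrite -expRB; congr expR; ring.
have -> : d = E * H / (X * Y) by rewrite -!expRD -expRB; congr expR; ring.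
have := expR_h_beta; move: H0 X0 Y0; move: H X Y E => H' X' Y' E' H0 X0 Y0 EH.
apply/eqP; rewrite -subr_eq0; apply/eqP.
transitivity (((1 - E') * H' - (X' + Y' - X' * Y' - E')) / H').
  by field; rewrite !gt_eqF.
by rewrite EH subrr mul0r.
Qed.

(** The sum on the right-hand side is the opposite of the logarithmic derivative, at
h_beta, of the limiting ratio of consecutive probabilities. *)
Lemma sqr_sigma_beta : sigma_beta beta x y ^+ 2 =
  beta * ((1 - a)^-1 + (1 - b)^-1 + H / (1 - H) + d / (1 - d)).
Proof.
have [h0 hx' hy' hd] := h_beta_bounds.
have a1 : 0 < 1 - a by apply: subr1_expRN_gt0; rewrite mulr_gt0 // subr_gt0.
have b1 : 0 < 1 - b by apply: subr1_expRN_gt0; rewrite mulr_gt0 // subr_gt0.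
have H1 : 0 < 1 - H by apply: subr1_expRN_gt0; rewrite mulr_gt0.
have d1 : 0 < 1 - d by apply: subr1_expRN_gt0; rewrite mulr_gt0.
have E1 : 0 < 1 - E by apply: subr1_expRN_gt0.
rewrite /sigma_beta !mulNr sqr_sqrtr; last first.
  by rewrite ltW // divr_gt0 // mulr_gt0.
rewrite -mulrA; congr (_ * _).
have EE : E = a * b * H * d by rewrite -!expRD; congr expR; ring.
have := h_beta_critical.
rewrite EE; move: a b H d a1 b1 H1 d1 => a' b' c d' a1 b1 c1 d1 crit.
have P0 : (1 - a') * (1 - b') != 0 by rewrite gt_eqF // mulr_gt0.
have Q0 : (1 - c) * (1 - d') != 0 by rewrite gt_eqF // mulr_gt0.
have Qi : ((1 - c) * (1 - d'))^-1 = a' * b' / ((1 - a') * (1 - b')).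
  by apply: (mulfI Q0); rewrite divff // mulrA mulrC [in _ * (a' * b')]mulrC -crit mulVf.
have -> : (1 - a')^-1 + (1 - b')^-1 + c / (1 - c) + d' / (1 - d') =
   (2 - a' - b') / ((1 - a') * (1 - b')) + (c + d' - 2 * c * d') * ((1 - c) * (1 - d'))^-1.
  by field; rewrite !gt_eqF.
rewrite Qi mulrA -mulrDl; congr (_ / _).
have -> : 1 - a' * b' * c * d' = 2 - a' - b' + (c + d' - 2 * c * d') * (a' * b')
  - ((1 - a') * (1 - b') - a' * b' * ((1 - c) * (1 - d'))) by ring.
by rewrite crit subrr subr0.
Qed.

Lemma lnm_critical :
  (beta * (x - h) + lnm (beta * (x - h))) + (beta * (y - h) + lnm (beta * (y - h)))
  - lnm (beta * h) - lnm (beta * (1 - x - y + h)) = 0.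
Proof.
have [h0 hx' hy' hd] := h_beta_bounds.
have a1 : 0 < 1 - a by apply: subr1_expRN_gt0; rewrite mulr_gt0 // subr_gt0.
have b1 : 0 < 1 - b by apply: subr1_expRN_gt0; rewrite mulr_gt0 // subr_gt0.
have H1 : 0 < 1 - H by apply: subr1_expRN_gt0; rewrite mulr_gt0.
have d1 : 0 < 1 - d by apply: subr1_expRN_gt0; rewrite mulr_gt0.
have := congr1 (@ln R) h_beta_critical.
rewrite !lnM ?posrE ?mulr_gt0 ?expR_gt0 //.
have lnE (u : R) : ln (expR u) = u by exact: expRK.
rewrite !lnE /lnm; lra.
Qed.

End Profile.

(** * Uniform first-order expansion of the ratios *)

(** Expansions u = v + k e + o(1 / r) along a filter, where r is large and e is
O(1 / r). *)
Section FirstOrder.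
Variables (R : realType) (I : Type) (F : set_system I).
Context {FF : Filter F}.

Lemma cvg0_bounded (f g : I -> R) (M : R) :
  f @ F --> 0 -> (\forall i \near F, `|g i| <= M) -> f i * g i @[i --> F] --> 0.
Proof.
move=> f0 gM; apply/cvgr0Pnorm_le => e e0.
have M1 : 0 < `|M| + 1 by rewrite ltr_wpDl.
have /cvgr0Pnorm_le /(_ _ (divr_gt0 e0 M1)) f0' := f0.
near=> i; rewrite normrM.
have -> : e = e / (`|M| + 1) * (`|M| + 1) by rewrite divfK // gt_eqF.
apply: ler_pM => //; first by near: i.
have : `|g i| <= M by near: i.
move=> /le_trans; apply; apply: le_trans (ler_norm _) _; lra.
Unshelve. all: by end_near. Qed.

Variables (r e : I -> R) (T : R).
Hypotheses (r_neq0 : \forall i \near F, r i != 0) (r_cvg : (r i)^-1 @[i --> F] --> 0)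
  (e_le : \forall i \near F, `|r i * e i| <= T).

Lemma first_order_cvg (u : I -> R) (v k : R) :
  r i * (u i - v - k * e i) @[i --> F] --> 0 -> u @ F --> v.
Proof.
move=> H.
have H1 : (r i)^-1 * (r i * (u i - v - k * e i)) @[i --> F] --> 0.
  by rewrite -(mulr0 0); apply: cvgM.
have H2 : k * ((r i)^-1 * (r i * e i)) @[i --> F] --> 0.
  by rewrite -(mulr0 k); apply: cvgM; [exact: cvg_cst|exact: cvg0_bounded r_cvg e_le].
rewrite -[v in _ --> v]addr0 -[X in _ + X](addr0 0).
apply: cvg_near_eq (cvgD (cvg_cst v) (cvgD H1 H2)).
near=> i; have r0 : r i != 0 by near: i.
by rewrite /= ?fctE; field.
Unshelve. all: by end_near. Qed.

(** Such an expansion can be composed with a function that is only differentiable at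
v: by Caratheodory, phi z - phi v = g z (z - v) with g continuous at v. *)
Lemma first_order_comp (phi : R -> R) (u : I -> R) (v k l : R) :
  is_derive v 1 phi l ->
  r i * (u i - v - k * e i) @[i --> F] --> 0 ->
  r i * (phi (u i) - phi v - l * k * e i) @[i --> F] --> 0.
Proof.
move=> /is_derive1_caratheodory [g [phiE gc gl]] H.
have uv := first_order_cvg H.
have gu : g (u i) - l @[i --> F] --> 0.
  rewrite -(subrr l) -[in X in _ --> X - _]gl; apply: cvgB; last exact: cvg_cst.
  exact: (cvg_comp _ _ uv gc).
have H1 : (g (u i) - l) * (r i * (u i - v - k * e i)) @[i --> F] --> 0.
  by rewrite -(mulr0 0); apply: cvgM.
have H2 : k * ((g (u i) - l) * (r i * e i)) @[i --> F] --> 0.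
  by rewrite -(mulr0 k); apply: cvgM; [exact: cvg_cst|exact: cvg0_bounded gu e_le].
have H3 : l * (r i * (u i - v - k * e i)) @[i --> F] --> 0.
  by rewrite -(mulr0 l); apply: cvgM => //; exact: cvg_cst.
rewrite -(addr0 0) -[X in X + _](addr0 0); apply: cvg_near_eq (cvgD (cvgD H1 H2) H3).
apply: nearW => i; rewrite !fctE phiE; ring.
Qed.

End FirstOrder.

Section Window.
Variables (R : realType) (h T : R).

(** The filter of statements on pairs (N, m) which hold for N large, uniformly in m
at distance at most T sqrt N from h N. *)
Definition window_filter : set_system (nat * nat) :=
  [set A | \forall N \near \oo, forall m : nat,
     `|m%:R - h * N%:R| <= T * Num.sqrt (N%:R : R) -> A (N, m)].

Global Instance window_filter_filter : Filter window_filter.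
Proof.
split; rewrite /window_filter /=.
- exact: nearW.
- move=> A B WA WB; rewrite /= in WA WB *; near=> N => m mw.
  by split; move: m mw; near: N.
- move=> A B AB WA; rewrite /= in WA *; near=> N => m mw.
  by apply: AB; move: m mw; near: N.
Unshelve. all: by end_near. Qed.

Lemma near_windowW (P : nat * nat -> Prop) :
  (\forall N \near \oo, forall m : nat,
     `|m%:R - h * N%:R| <= T * Num.sqrt (N%:R : R) -> P (N, m)) ->
  \forall i \near window_filter, P i.
Proof. by []. Qed.

Lemma near_window_fst (P : nat -> Prop) :
  (\forall N \near \oo, P N) -> \forall i \near window_filter, P i.1.
Proof. by move=> Poo; apply: near_windowW; near=> N => m _ /=; near: N.
Unshelve. all: by end_near. Qed.

Lemma cvg_window_fst (U : topologicalType) (f : nat -> U) (l : U) :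
  f @ \oo --> l -> f i.1 @[i --> window_filter] --> l.
Proof. by move=> fl A /fl; exact: near_window_fst. Qed.

Let r (i : nat * nat) : R := Num.sqrt i.1%:R.
Let dev (i : nat * nat) : R := (i.2%:R - h * i.1%:R) / i.1%:R.

Lemma window_sqrt_gt0 : \forall i \near window_filter, 0 < r i.
Proof.
by apply: (@near_window_fst (fun N => 0 < Num.sqrt (N%:R : R))); exact: near_sqrt_gt0.
Qed.

Lemma window_sqr i : i.1%:R = r i ^+ 2.
Proof. by rewrite sqr_sqrtr. Qed.

Lemma window_in : \forall i \near window_filter, `|i.2%:R - h * i.1%:R| <= T * r i.
Proof. by apply: near_windowW; apply: nearW. Qed.

Lemma window_dev_le : \forall i \near window_filter, `|r i * dev i| <= T.
Proof.
near=> i.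
have r0 : 0 < r i by near: i; exact: window_sqrt_gt0.
have : `|i.2%:R - h * i.1%:R| <= T * r i by near: i; exact: window_in.
rewrite -ler_pdivrMr // -{1}(ger0_norm (ltW r0)) -normfV -normrM.
apply: le_trans; rewrite le_eqVlt; apply/orP; left; apply/eqP; congr `| _ |.
by rewrite /dev [X in _ / X]window_sqr; field; rewrite gt_eqF.
Unshelve. all: by end_near. Qed.

End Window.

Section Rate.
Variables (R : realType) (beta : R).
Hypothesis beta0 : 0 < beta.

(** The parameter tau such that 1 - beta / N = e^(-tau), for N > beta. *)
Definition rate (N : nat) : R := - ln (1 - beta / N%:R).

Lemma near_rate : \forall N \near \oo,
  [/\ 0 < N%:R :> R, expR (- rate N) = 1 - beta / N%:R, 0 < rate N &
      0 <= N%:R * rate N - beta <= 2 * beta ^+ 2 / N%:R].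
Proof.
near=> N.
have N2 : 2 * beta <= N%:R by near: N; exact: nbhs_infty_ger.
have N0 : 0 < N%:R :> R by apply: lt_le_trans N2; rewrite mulr_gt0.
have z0 : 0 < beta / N%:R by rewrite divr_gt0.
have z1 : beta / N%:R <= 2^-1 by rewrite ler_pdivrMr //; lra.
have q0 : 0 < 1 - beta / N%:R by lra.
have lo : beta / N%:R <= rate N.
  have := @le_ln1Dx R (- (beta / N%:R)); rewrite /rate; lra.
have hi : rate N <= beta / N%:R / (1 - beta / N%:R).
  rewrite /rate -lnV ?posrE //.
  have E : (1 - beta / N%:R)^-1 = 1 + beta / N%:R / (1 - beta / N%:R).
    by field; rewrite !gt_eqF //; lra.
  have : ln (1 + beta / N%:R / (1 - beta / N%:R)) <= beta / N%:R / (1 - beta / N%:R).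
    by apply: le_ln1Dx; apply: (@lt_trans _ _ 0); rewrite ?divr_gt0 // oppr_lt0.
  by rewrite -E.
split => //.
- by rewrite /rate opprK lnK.
- exact: lt_le_trans lo.
- apply/andP; split.
    by rewrite subr_ge0 mulrC -ler_pdivrMr.
  rewrite lerBlDr; apply: (@le_trans _ _ (N%:R * (beta / N%:R / (1 - beta / N%:R)))).
    by rewrite ler_wpM2l // ltW.
  have -> : N%:R * (beta / N%:R / (1 - beta / N%:R)) = beta + beta ^+ 2 / N%:R / (1 - beta / N%:R).
    by field; rewrite !gt_eqF //; lra.
  rewrite addrC lerD2r ler_pdivrMr //.
  have : 0 < beta ^+ 2 / N%:R by rewrite divr_gt0 // exprn_gt0.
  by rewrite -[2 * _ / _]mulrA; nra.
Unshelve. all: by end_near. Qed.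

Lemma rate_cvg : Num.sqrt N%:R * (N%:R * rate N - beta) @[N --> \oo] --> 0.
Proof.
apply: (@squeeze_cvgr _ _ _ _ (fun=> 0) (fun N => 2 * beta ^+ 2 * (Num.sqrt N%:R)^-1)).
- near=> N.
  have [N0 _ _ /andP[A B]] : [/\ 0 < N%:R :> R, expR (- rate N) = 1 - beta / N%:R,
      0 < rate N & 0 <= N%:R * rate N - beta <= 2 * beta ^+ 2 / N%:R].
    by near: N; exact: near_rate.
  have q0 : 0 < Num.sqrt N%:R :> R by rewrite sqrtr_gt0.
  rewrite mulr_ge0 ?sqrtr_ge0 //=.
  apply: (@le_trans _ _ (Num.sqrt N%:R * (2 * beta ^+ 2 / N%:R))).
    by rewrite ler_wpM2l // ltW.
  rewrite -[X in _ / X](@sqr_sqrtr R N%:R) //.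
  rewrite le_eqVlt; apply/orP; left; apply/eqP.
  by field; rewrite gt_eqF.
- exact: cvg_cst.
- rewrite -(mulr0 (2 * beta ^+ 2)); apply: cvgM; [exact: cvg_cst|exact: cvgr_invsqrt_natr].
Unshelve. all: by end_near. Qed.

End Rate.

(** Replacing x N by its integer part costs at most 1 / N after division by N. *)
Lemma trunc_cvg (R : realType) (x : R) : 0 <= x ->
  Num.sqrt N%:R * ((Num.truncn (x * N%:R))%:R / N%:R - x) @[N --> \oo] --> 0.
Proof.
move=> x0; apply: (@squeeze_cvgr _ _ _ _ (fun N => - (Num.sqrt N%:R)^-1) (fun=> 0)).
- near=> N.
  have q0 : 0 < Num.sqrt N%:R :> R by near: N; exact: near_sqrt_gt0.
  have /truncn_itv/andP[] : 0 <= x * N%:R by rewrite mulr_ge0.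
  rewrite -natr1; move: (Num.truncn _)%:R => k k1 k2.
  have -> : Num.sqrt N%:R * (k / N%:R - x) = (k - x * N%:R) / Num.sqrt N%:R.
    move: k1 k2 q0 => _ _; have := @sqr_sqrtr R N%:R (ler0n _ _).
    by move: (Num.sqrt N%:R) => q <- q0; field; rewrite gt_eqF.
  rewrite -mulN1r ler_pM2r ?invr_gt0 //; apply/andP; split; first lra.
  by rewrite pmulr_lle0 ?invr_gt0 //; lra.
- by rewrite -oppr0; apply: cvgN; exact: cvgr_invsqrt_natr.
- exact: cvg_cst.
Unshelve. all: by end_near. Qed.

Lemma natr_sub_le (R : realDomainType) (n l k m : nat) :
  0 < n%:R - l%:R - k%:R + m%:R + 1 :> R -> (l + k - n <= m)%N.
Proof.
move=> H; rewrite leq_subLR -ltnS -(ltr_nat R) -natr1 !natrD.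
by rewrite -subr_gt0; move: H; congr (_ < _); ring.
Qed.

Section Slope.
Variables (R : realType) (beta x y T : R).
Hypotheses (beta0 : 0 < beta) (hx : 0 < x < 1) (hy : 0 < y < 1).
Local Notation h := (h_beta beta x y).
Local Notation W := (window_filter h T).

Let r (i : nat * nat) : R := Num.sqrt i.1%:R.
Let dev (i : nat * nat) : R := (i.2%:R - h * i.1%:R) / i.1%:R.
Let L (i : nat * nat) : R := (Num.truncn (x * i.1%:R))%:R.
Let K (i : nat * nat) : R := (Num.truncn (y * i.1%:R))%:R.

Let r_neq0 : \forall i \near W, r i != 0.
Proof. by apply: filterS (@window_sqrt_gt0 _ h T) => i /lt0r_neq0. Qed.

Let r_cvg : (r i)^-1 @[i --> W] --> 0.
Proof. exact: (@cvg_window_fst _ h T _ _ _ (@cvgr_invsqrt_natr R)). Qed.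

Let dev_le := @window_dev_le R h T.

(* An expansion of n / N gives one of rate * n, as N * rate = beta + o(1 / sqrt N). *)
Let rate_linear (n : nat * nat -> R) (u k : R) :
  r i * (n i / i.1%:R - u - k * dev i) @[i --> W] --> 0 ->
  r i * (rate beta i.1 * n i - beta * u - (beta * k) * dev i) @[i --> W] --> 0.
Proof.
move=> H; have nu := first_order_cvg r_neq0 r_cvg dev_le H.
have H1 : r i * (i.1%:R * rate beta i.1 - beta) * (n i / i.1%:R) @[i --> W] --> 0.
  rewrite -(mul0r u); apply: cvgM; last exact: nu.
  exact: (@cvg_window_fst _ h T _ _ _ (rate_cvg beta0)).
have H2 : beta * (r i * (n i / i.1%:R - u - k * dev i)) @[i --> W] --> 0.
  by rewrite -(mulr0 beta); apply: cvgM => //; exact: cvg_cst.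
rewrite -(addr0 0); apply: cvg_near_eq (cvgD H1 H2).
near=> i; rewrite /= ?fctE.
have r0 : r i != 0 by near: i.
have i0 : i.1%:R != 0 :> R by rewrite (window_sqr R i) expf_neq0.
by rewrite /dev; field.
Unshelve. all: by end_near. Qed.

Let cvg_L : r i * (L i / i.1%:R - x) @[i --> W] --> 0.
Proof.
have x0 : 0 <= x by case/andP: hx => /ltW.
exact: (@cvg_window_fst _ h T _ _ _ (trunc_cvg x0)).
Qed.

Let cvg_K : r i * (K i / i.1%:R - y) @[i --> W] --> 0.
Proof.
have y0 : 0 <= y by case/andP: hy => /ltW.
exact: (@cvg_window_fst _ h T _ _ _ (trunc_cvg y0)).
Qed.

(* The expansions of the four arguments of lnm in logratio, divided by N * rate. *)
Let cvg_Lm : r i * ((L i - i.2%:R) / i.1%:R - (x - h) - (-1) * dev i) @[i --> W] --> 0.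
Proof.
apply: cvg_near_eq cvg_L; near=> i.
have r0 : r i != 0 by near: i.
have i0 : i.1%:R != 0 :> R by rewrite (window_sqr R i) expf_neq0.
by rewrite /dev; field.
Unshelve. all: by end_near. Qed.

Let cvg_Km : r i * ((K i - i.2%:R) / i.1%:R - (y - h) - (-1) * dev i) @[i --> W] --> 0.
Proof.
apply: cvg_near_eq cvg_K; near=> i.
have r0 : r i != 0 by near: i.
have i0 : i.1%:R != 0 :> R by rewrite (window_sqr R i) expf_neq0.
by rewrite /dev; field.
Unshelve. all: by end_near. Qed.

Let cvg_m : r i * ((i.2%:R + 1) / i.1%:R - h - 1 * dev i) @[i --> W] --> 0.
Proof.
apply: cvg_near_eq r_cvg; near=> i.
have r0 : r i != 0 by near: i.
have E : i.1%:R = r i ^+ 2 := window_sqr R i.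
by rewrite /dev; move: (r i) r0 E => q r0 ->; field.
Unshelve. all: by end_near. Qed.

Let cvg_rest : r i * ((i.1%:R - L i - K i + i.2%:R + 1) / i.1%:R - (1 - x - y + h)
  - 1 * dev i) @[i --> W] --> 0.
Proof.
have := cvgB cvg_m (cvgD cvg_L cvg_K); rewrite addr0 subrr => H.
apply: cvg_near_eq (H _ _); near=> i.
have r0 : r i != 0 by near: i.
have i0 : i.1%:R != 0 :> R by rewrite (window_sqr R i) expf_neq0.
by rewrite /= ?fctE /dev; field.
Unshelve. all: by end_near. Qed.

Lemma logratio_first_order :
  r i * (logratio (rate beta i.1) i.1%:R (L i) (K i) i.2%:R
    + sigma_beta beta x y ^+ 2 * dev i) @[i --> W] --> 0.
Proof.
have [h0 hx' hy' hd] := h_beta_bounds beta0 hx hy.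
have v1 : 0 < beta * (x - h) by rewrite mulr_gt0 // subr_gt0.
have v2 : 0 < beta * (y - h) by rewrite mulr_gt0 // subr_gt0.
have v3 : 0 < beta * h by rewrite mulr_gt0.
have v4 : 0 < beta * (1 - x - y + h) by rewrite mulr_gt0.
have C1 := first_order_comp r_neq0 r_cvg dev_le (is_derive_id_lnm v1) (rate_linear cvg_Lm).
have C2 := first_order_comp r_neq0 r_cvg dev_le (is_derive_id_lnm v2) (rate_linear cvg_Km).
have C3 := first_order_comp r_neq0 r_cvg dev_le (is_derive_lnm v3) (rate_linear cvg_m).
have C4 := first_order_comp r_neq0 r_cvg dev_le (is_derive_lnm v4) (rate_linear cvg_rest).
have C5 : r i * rate beta i.1 @[i --> W] --> 0.
  have H1 : (r i)^-1 * (beta + (r i)^-1 * (r i * (i.1%:R * rate beta i.1 - beta)))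
      @[i --> W] --> 0.
    rewrite -(mul0r (beta + 0 * 0)); apply: cvgM; first exact: r_cvg.
    apply: cvgD; first exact: cvg_cst.
    apply: cvgM; first exact: r_cvg.
    exact: (@cvg_window_fst _ h T _ _ _ (rate_cvg beta0)).
  apply: cvg_near_eq H1; near=> i.
  have r0 : r i != 0 by near: i.
  have E : i.1%:R = r i ^+ 2 := window_sqr R i.
  by move: (rate _ _) (r i) r0 E => t q r0 ->; field.
have := cvgB (cvgB (cvgB (cvgD (C1 _) (C2 _)) C5) (C3 _)) (C4 _).
rewrite addr0 !subr0 => CC.
apply: cvg_near_eq (CC _ _ _ _ _ _ _ _); near=> i.
rewrite /= ?fctE (sqr_sigma_beta beta0 hx hy) /logratio.
(* The values at the centre cancel by criticality of h; the slopes add up to the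
   opposite of sigma^2. *)
rewrite -[RHS]subr0 -(mulr0 (r i)) -(lnm_critical beta0 hx hy) /dev.
rewrite -/(r i).
move: (1 - expR (- (beta * (x - h))))^-1 (1 - expR (- (beta * (y - h))))^-1 => A1 A2.
move: (expR (- (beta * h)) / _) (expR (- (beta * (1 - x - y + h))) / _) => A3 A4.
ring.
Unshelve. all: by end_near. Qed.

(** At distance O(sqrt N) from h N, m lies in the interior of the support, because
x - h, y - h and 1 - x - y + h are positive. *)
Lemma window_interior : \forall i \near W,
  (Num.truncn (x * i.1%:R) + Num.truncn (y * i.1%:R) - i.1 <= i.2 <
   minn (Num.truncn (x * i.1%:R)) (Num.truncn (y * i.1%:R)))%N.
Proof.
have [h0 hx' hy' hd] := h_beta_bounds beta0 hx hy.
have C1 := first_order_cvg r_neq0 r_cvg dev_le cvg_Lm.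
have C2 := first_order_cvg r_neq0 r_cvg dev_le cvg_Km.
have C3 := first_order_cvg r_neq0 r_cvg dev_le cvg_rest.
have v1 : 0 < x - h by rewrite subr_gt0.
have v2 : 0 < y - h by rewrite subr_gt0.
have N1 := cvgr_gt _ (C1 _) _ v1; have N2 := cvgr_gt _ (C2 _) _ v2.
have N3 := cvgr_gt _ (C3 _) _ hd.
near=> i.
have r0 : 0 < r i by near: i; exact: window_sqrt_gt0.
have i0 : 0 < i.1%:R :> R by rewrite (window_sqr R i) exprn_gt0.
have : 0 < (L i - i.2%:R) / i.1%:R by near: i; exact: N1.
have : 0 < (K i - i.2%:R) / i.1%:R by near: i; exact: N2.
have : 0 < (i.1%:R - L i - K i + i.2%:R + 1) / i.1%:R by near: i; exact: N3.
rewrite /L /K !pmulr_lgt0 ?invr_gt0 // !subr_gt0 !ltr_nat leq_min => H -> ->.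
by rewrite andbT (natr_sub_le H).
Unshelve. all: by end_near. Qed.

End Slope.

(** * The local limit theorem for the height function *)

Lemma mallows_prob_zext (R : realType) (q : R) (N L K : nat) (z : int) :
  mallows_prob q (fun w : 'S_N => Posz (height L K w) == z) =
  zext (fun m => mallows_prob q (fun w : 'S_N => height L K w == m)) z.
Proof. by case: z => m //=; rewrite /mallows_prob big_pred0. Qed.

Lemma sigma_beta_gt0 (R : realType) (beta x y : R) :
  0 < beta -> 0 < x < 1 -> 0 < y < 1 -> 0 < sigma_beta beta x y.
Proof.
move=> beta0 hx hy; have [h0 hx' hy' hd] := h_beta_bounds beta0 hx hy.
rewrite /sigma_beta !mulNr sqrtr_gt0 divr_gt0 ?mulr_gt0 // subr1_expRN_gt0 //.
  by rewrite mulr_gt0 // subr_gt0.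
by rewrite mulr_gt0 // subr_gt0.
Qed.

Lemma truncn_le_nat (R : realType) (x : R) (N : nat) :
  0 < x < 1 -> (Num.truncn (x * N%:R) <= N)%N.
Proof.
move=> /andP[x0 x1]; rewrite -(ler_nat R) (le_trans (y := x * N%:R)) //.
  by rewrite truncn_le mulr_ge0 // ltW.
by rewrite ler_piMl // ltW.
Qed.

Theorem theorem1p1 (R : realType) (alpha beta x y : R)
    (hbeta : 0 < beta) (hx : 0 < x < 1) (hy : 0 < y < 1) :
  (Num.sqrt (2 * pi * N%:R) / sigma_beta beta x y *
     mallows_prob (1 - beta / N%:R)
       (fun w : 'S_N =>
          Posz (height (Num.truncn (x * N%:R)) (Num.truncn (y * N%:R)) w) ==
          Num.floor (h_beta beta x y * N%:R + alpha * Num.sqrt N%:R)))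
    @[N --> \oo]
  --> expR (- (sigma_beta beta x y ^+ 2 / 2) * alpha ^+ 2).
Proof.
pose L N := Num.truncn (x * N%:R : R); pose K N := Num.truncn (y * N%:R : R).
pose p N (m : nat) :=
  mallows_prob (1 - beta / N%:R) (fun w : 'S_N => height (L N) (K N) w == m).
pose lo N := (L N + K N - N)%N; pose hi N := minn (L N) (K N).
have LN N : (L N <= N)%N := truncn_le_nat N hx.
have KN N : (K N <= N)%N := truncn_le_nat N hy.
have s0 := sigma_beta_gt0 hbeta hx hy.
have s20 : 0 < sigma_beta beta x y ^+ 2 by rewrite exprn_gt0.
have [h0 _ _ _] := h_beta_bounds hbeta hx hy.
have near_q : \forall N \near \oo, 1 - beta / N%:R = expR (- rate beta N) /\ 0 < rate beta N.
  by apply: filterS (near_rate hbeta) => N [_ -> ? _].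
have q01 N : 0 < rate beta N -> 0 < expR (- rate beta N) < 1.
  by move=> r0; rewrite expR_gt0 expR_lt1 oppr_lt0.
have p_gt0 : \forall N \near \oo, forall m, (lo N <= m <= hi N)%N -> 0 < p N m.
  by apply: filterS near_q => N [E /q01 Q] m; rewrite /p E; exact: mallows_height_gt0.
have p_out : \forall N \near \oo, forall m, ~~ (lo N <= m <= hi N)%N -> p N m = 0.
  by apply: filterS near_q => N [E /q01 Q] m; rewrite /p E; exact: mallows_height_out.
have p_sum : \forall N \near \oo, \sum_(m < (hi N).+1) p N m = 1.
  by apply: filterS near_q => N [E /q01 Q]; rewrite /p E; exact: mallows_height_sum.
have p_step : \forall N \near \oo, forall m, (lo N <= m < hi N)%N ->
    ln (p N m.+1) - ln (p N m) = logratio (rate beta N) N%:R (L N)%:R (K N)%:R m%:R.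
  by apply: filterS near_q => N [E rN] m; rewrite /p E; exact: ln_mallows_height_step.
have p_conc : \forall N \near \oo, forall m n,
    (lo N <= m)%N -> (m <= n)%N -> (n < hi N)%N ->
    ln (p N n.+1) - ln (p N n) <= ln (p N m.+1) - ln (p N m).
  apply: filterS2 near_q p_step => N [_ rN] step m n lm mn nh.
  have [mh ln'] : (m < hi N)%N /\ (lo N <= n)%N by split; lia.
  rewrite !step ?lm ?ln' //; move: nh; rewrite leq_min => /andP[nL nK].
  apply: logratio_anti; rewrite ?ler0n ?ler_nat ?ltr_nat //.
  by rewrite -!natrD natr1 ltr_nat; move: lm; rewrite /lo; lia.
have p_slope (T e : R) : 0 < e -> \forall N \near \oo, forall m : nat,
    `|m%:R - h_beta beta x y * N%:R| <= T * Num.sqrt N%:R ->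
    (lo N <= m < hi N)%N /\
    `|ln (p N m.+1) - ln (p N m) + sigma_beta beta x y ^+ 2 *
       ((m%:R - h_beta beta x y * N%:R) / N%:R)| <= e / Num.sqrt N%:R.
  move=> e0.
  have /cvgr0Pnorm_le/(_ e e0) A := logratio_first_order T hbeta hx hy.
  have B := window_interior T hbeta hx hy.
  near=> N => m mw.
  have mi : (lo N <= m < hi N)%N by move: m mw; near: N; exact: B.
  split => //.
  have -> : ln (p N m.+1) - ln (p N m) = logratio (rate beta N) N%:R (L N)%:R (K N)%:R m%:R.
    by move: m mi {mw}; near: N.
  have q0 : 0 < Num.sqrt N%:R :> R by near: N; exact: near_sqrt_gt0.
  rewrite ler_pdivlMr // mulrC -{1}(ger0_norm (ltW q0)) -normrM.
  by move: m mw {mi}; near: N; exact: A.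
have c0 : Num.sqrt (2 * pi) != 0 :> R by rewrite gt_eqF // sqrtr_gt0 mulr_gt0 // pi_gt0.
have H := log_concave_local_limit (t := alpha) h0 s20 p_gt0 p_out p_conc p_sum p_slope.
have -> : expR (- (sigma_beta beta x y ^+ 2 / 2) * alpha ^+ 2) =
  Num.sqrt (2 * pi) / sigma_beta beta x y *
  (expR (- sigma_beta beta x y ^+ 2 / 2 * alpha ^+ 2) /
   Num.sqrt (2 * pi / sigma_beta beta x y ^+ 2)).
  rewrite [Num.sqrt (2 * pi / _)]sqrtrM ?mulr_ge0 ?pi_ge0 // -exprVn sqrtr_sqr.
  rewrite ger0_norm ?invr_ge0 ?(ltW s0) // -mulNr.
  by field; rewrite c0 gt_eqF.
apply: cvg_near_eq (cvgM (cvg_cst (Num.sqrt (2 * pi) / sigma_beta beta x y)) H).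
apply: nearW => N; rewrite /= ?fctE mallows_prob_zext -/(p N).
rewrite [Num.sqrt (2 * pi * _)]sqrtrM ?mulr_ge0 ?pi_ge0 //.
ring.
Unshelve. all: by end_near. Qed.
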